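(* Let $k$ be a real constant and let $f(u_1,u_2)$, $f\in\mathcal{S}'(\mathbb{R}^2)$, be a solution of the Helmholtz equation $$\partial_1^2 f+\partial_2^2 f+k^2 f=0 .$$ Then the two-dimensional metamorphism of $f$ has the form $\mathcal{M}f=\mathcal{G}f_4$ for a function $f_4(z_1,w_1;z_2,w_2)$ holomorphic in four complex variables, which satisfies the first-order differential equation $$2w_1\left(z_1\partial_{z_1}f_4+w_1\partial_{w_1}f_4\right)+2w_2\left(z_2\partial_{z_2}f_4+w_2\partial_{w_2}f_4\right)+\left(w_1+w_2+\frac{k^2}{2\pi i\hbar}\right)f_4=0 .$$
   Context: Fix a constant $\hbar>0$. The two-dimensional metamorphism is obtained by applying the one-dimensional metamorphism in each variable: for $f(u_1,u_2)$ on $\mathbb{R}^2$, $\mathcal{M}f$ is the function of $(x_1,y_1,b_1,r_1;x_2,y_2,b_2,r_2)$, with $x_j,y_j,b_j\in\mathbb{R}$ and $r_j>0$, given by $$[\mathcal{M}f](x_1,y_1,b_1,r_1;x_2,y_2,b_2,r_2)=\hbar\sqrt{r_1r_2}\int_{\mathbb{R}^2} f(u_1,u_2)\prod_{j=1}^{2}\exp\left(-\pi\hbar\left((r_j^2-ib_j)(u_j-y_j)^2+2i(u_j-y_j)x_j\right)\right)du_1\,du_2 .$$ For $f\in\mathcal{S}'(\mathbb{R}^2)$ the integral is understood as the (bilinear) pairing of $f$ with the integral kernel, which is a Schwartz function of $(u_1,u_2)$; derivatives of $f$ are distributional. For a holomorphic function $f_4(z_1,w_1;z_2,w_2)$, with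 $z_j\in\mathbb{C}$ and $\operatorname{Im}w_j>0$, the function $\mathcal{G}f_4$ is $$[\mathcal{G}f_4](x_1,y_1,b_1,r_1;x_2,y_2,b_2,r_2)=\sqrt{r_1r_2}\;e^{-\pi i\hbar(x_1^2/w_1+x_2^2/w_2)}\,f_4(z_1,w_1;z_2,w_2),$$ where $w_j=b_j+ir_j^2$ and $z_j=x_j+(b_j+ir_j^2)y_j=x_j+w_jy_j$ for $j=1,2$. *)

(* Defs.v *)
(* Stdlib reals with Coquelicot. *)
From Stdlib Require Import Reals.
From Coquelicot Require Import Coquelicot.
Open Scope R_scope.

Definition Cexp (z : C) : C :=
  (RtoC (exp (Re z)) * (cos (Im z), sin (Im z)))%C.

(** ** Schwartz functions on R^2 *)

(* Meaningful when the corresponding partial derivative exists, which [is_Ck]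
   below requires: [Derive] is total. *)
Definition CDerive (g : R -> C) (t : R) : C :=
  (Derive (fun s => Re (g s)) t, Derive (fun s => Im (g s)) t).

Definition D1 (phi : R * R -> C) (u : R * R) : C :=
  CDerive (fun s => phi (s, snd u)) (fst u).

Definition D2 (phi : R * R -> C) (u : R * R) : C :=
  CDerive (fun s => phi (fst u, s)) (snd u).

(* [C_R_NormedModule] is C as a real normed space. *)
Definition ex_partials (phi : R * R -> C) (u : R * R) : Prop :=
  ex_derive (K := R_AbsRing) (V := C_R_NormedModule)
    (fun s => phi (s, snd u)) (fst u) /\
  ex_derive (K := R_AbsRing) (V := C_R_NormedModule)
    (fun s => phi (fst u, s)) (snd u).

Fixpoint is_Ck (n : nat) (phi : R * R -> C) : Prop :=
  (forall u, continuous phi u) /\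
  match n with
  | O => True
  | S m => (forall u, ex_partials phi u) /\ is_Ck m (D1 phi) /\ is_Ck m (D2 phi)
  end.

Definition smooth (phi : R * R -> C) : Prop := forall n, is_Ck n phi.

(* The seminorm sup_u |u_1^a u_2^b (d_1^m d_2^n phi)(u)| is at most M. *)
Definition seminorm_le (a b m n : nat) (phi : R * R -> C) (M : R) : Prop :=
  forall u : R * R,
    Rabs (fst u ^ a * snd u ^ b) *
      Cmod (Nat.iter m D1 (Nat.iter n D2 phi) u) <= M.

Definition schwartz (phi : R * R -> C) : Prop :=
  smooth phi /\ forall a b m n, exists M, seminorm_le a b m n phi M.

(** ** Tempered distributions on R^2 *)

(* A distribution is a map on all functions R^2 -> C of which only the values
   on Schwartz functions matter.  Continuity is with respect to the locally
   convex topology generated by the seminorms above. *)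
Record tempered (T : (R * R -> C) -> C) : Prop := {
  tempered_plus : forall phi psi, schwartz phi -> schwartz psi ->
    T (fun u => phi u + psi u)%C = (T phi + T psi)%C;
  tempered_scal : forall (c : C) phi, schwartz phi ->
    T (fun u => c * phi u)%C = (c * T phi)%C;
  tempered_continuous : forall phi, schwartz phi -> forall eps : posreal,
    exists (N : nat) (delta : posreal), forall psi, schwartz psi ->
      (forall a b m n : nat,
         (a <= N)%nat -> (b <= N)%nat -> (m <= N)%nat -> (n <= N)%nat ->
         seminorm_le a b m n (fun u => psi u - phi u)%C delta) ->
      Cmod (T psi - T phi) < eps
}.

Definition dist_D1 (T : (R * R -> C) -> C) (phi : R * R -> C) : C :=
  (- T (D1 phi))%C.

Definition dist_D2 (T : (R * R -> C) -> C) (phi : R * R -> C) : C :=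
  (- T (D2 phi))%C.

Definition helmholtz (k : R) (T : (R * R -> C) -> C) : Prop :=
  forall phi, schwartz phi ->
    (dist_D1 (dist_D1 T) phi + dist_D2 (dist_D2 T) phi
       + RtoC (k ^ 2) * T phi)%C = 0%C.

(** ** The metamorphism *)

Definition kernel1 (hbar x y b r u : R) : C :=
  Cexp (- RtoC (PI * hbar) *
          ((RtoC (r ^ 2) - Ci * RtoC b) * RtoC ((u - y) ^ 2)
           + 2 * Ci * RtoC ((u - y) * x)))%C.

Definition metamorphism (hbar : R) (T : (R * R -> C) -> C)
    (x1 y1 b1 r1 x2 y2 b2 r2 : R) : C :=
  (RtoC (hbar * sqrt (r1 * r2)) *
     T (fun u => kernel1 hbar x1 y1 b1 r1 (fst u) *
                 kernel1 hbar x2 y2 b2 r2 (snd u)))%C.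

(** ** Holomorphic functions of four variables *)

Definition C2_NormedModule : NormedModule C_AbsRing :=
  prod_NormedModule C_AbsRing C_NormedModule C_NormedModule.
Definition C3_NormedModule : NormedModule C_AbsRing :=
  prod_NormedModule C_AbsRing C2_NormedModule C_NormedModule.
Definition C4_NormedModule : NormedModule C_AbsRing :=
  prod_NormedModule C_AbsRing C3_NormedModule C_NormedModule.

(* Complex (Frechet) differentiability at every point of D, which is meant to
   be open. *)
Definition holomorphic_on (D : C * C * C * C -> Prop)
    (F : C * C * C * C -> C) : Prop :=
  forall p, D p ->
    ex_filterdiff (K := C_AbsRing) (U := C4_NormedModule) (V := C_NormedModule)
      F (locally (T := C4_NormedModule) p).

(* Points are ordered as (z1, w1, z2, w2). *)
Definition phase_domain (p : C * C * C * C) : Prop :=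
  let '(_, w1, _, w2) := p in 0 < Im w1 /\ 0 < Im w2.

Definition calG (hbar : R) (f4 : C * C * C * C -> C)
    (x1 y1 b1 r1 x2 y2 b2 r2 : R) : C :=
  let w1 : C := (RtoC b1 + Ci * RtoC (r1 ^ 2))%C in
  let w2 : C := (RtoC b2 + Ci * RtoC (r2 ^ 2))%C in
  let z1 : C := (RtoC x1 + w1 * RtoC y1)%C in
  let z2 : C := (RtoC x2 + w2 * RtoC y2)%C in
  (RtoC (sqrt (r1 * r2)) *
     Cexp (- RtoC PI * Ci * RtoC hbar *
             (RtoC (x1 ^ 2) / w1 + RtoC (x2 ^ 2) / w2)) *
     f4 (z1, w1, z2, w2))%C.

(* [C_derive] is total; it is the complex derivative where that exists, in
   particular where F is holomorphic. *)
Definition dz1 (F : C * C * C * C -> C) (z1 w1 z2 w2 : C) : C :=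
  C_derive (fun z => F (z, w1, z2, w2)) z1.
Definition dw1 (F : C * C * C * C -> C) (z1 w1 z2 w2 : C) : C :=
  C_derive (fun w => F (z1, w, z2, w2)) w1.
Definition dz2 (F : C * C * C * C -> C) (z1 w1 z2 w2 : C) : C :=
  C_derive (fun z => F (z1, w1, z, w2)) z2.
Definition dw2 (F : C * C * C * C -> C) (z1 w1 z2 w2 : C) : C :=
  C_derive (fun w => F (z1, w1, z2, w)) w2.

(* Main.v *)
Require Import Defs.
From Stdlib Require Import Reals Lra Lia FunctionalExtensionality.
From Coquelicot Require Import Coquelicot.
Open Scope R_scope.

(** Put kappa = i pi hbar and w = b + i r^2, z = x + w y.  Expanding the square in
    the kernel gives, in each variable,

      kernel1 = exp (- kappa x^2 / w) exp (kappa z^2 / w) exp (kappa (w u^2 - 2 z u)),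

    because r^2 - i b = - i w and (z^2 - x^2) / w = 2 x y + w y^2
    ([kernel1_gauss]).  So the metamorphism of T is calG of the function

      f4 (p) = hbar exp (kappa (z1^2 / w1 + z2^2 / w2)) T (gauss p),

    where gauss p (u) = exp (kappa (w1 u1^2 - 2 z1 u1 + w2 u2^2 - 2 z2 u2)) and
    p = (z1, w1, z2, w2) ([metamorphism_reduced]).

    The differential equation holds because the gaussians exp (kappa w (u - z / w)^2)
    already satisfy it, up to a Laplacian.  The operator 2 w (z d_z + w d_w) and the operator d_u^2 both
    multiply such a gaussian by polynomials in u, and these agree up to
    the factor 2 kappa and the term w:
    2 w (z d_z + w d_w) = - w + d_u^2 / (2 kappa).  Summed over the two variables, the
    Laplacian falls on the test function, and by the Helmholtz equation T sends it
    to - k^2 T (gauss p).  In the proof all of this is a linear identity between the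
    moments T (gauss), T (u_i gauss) and T (u_i^2 gauss), of which the Helmholtz
    equation is [helmholtz_moments].

    What remains is that p -> T (gauss p) is holomorphic and that its gradient may
    be computed under T ([has_grad_pairing]).  The phase is linear in p, so the
    difference gauss (p + h) - gauss p - phase h * gauss p is
    gauss p * (exp (phase h) - 1 - phase h), which is O(|h|^2) in every
    Schwartz seminorm.  The estimate of all seminorms at once comes from the
    inductive class [tame]: it contains the gaussian, its increment and its
    first-order Taylor remainder, with the exponents 0, 1, 2 of |h|, and it is stable
    under differentiation in u ([tame_pder]) and under multiplication by coordinates.
    Hence a pointwise bound for its members ([tame_decreasing]) bounds every seminorm, and
    the continuity of T turns these bounds into bounds of T ([tame_tempered]).
    With a quadratic remainder as the definition of differentiability ([has_grad]),
    the product and chain rules are algebra of O(|h|^k). *)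

(** * The complex exponential *)

Lemma Cexp_pair (z : C) : Cexp z = (exp (Re z) * cos (Im z), exp (Re z) * sin (Im z)).
Proof. unfold Cexp, RtoC, Cmult; simpl; f_equal; ring. Qed.

Lemma Cexp_plus (a b : C) : Cexp (a + b) = (Cexp a * Cexp b)%C.
Proof.
rewrite !Cexp_pair; destruct a as [a1 a2], b as [b1 b2]; unfold Cmult; simpl.
rewrite exp_plus, cos_plus, sin_plus; f_equal; ring.
Qed.

Lemma Cexp_0 : Cexp 0 = 1%C.
Proof. rewrite Cexp_pair; simpl; rewrite exp_0, cos_0, sin_0; unfold RtoC; f_equal; ring. Qed.

Lemma Cmod_Cexp (z : C) : Cmod (Cexp z) = exp (Re z).
Proof.
unfold Cexp; rewrite Cmod_mult, Cmod_R, Rabs_pos_eq by (left; apply exp_pos).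
replace (Cmod (cos (Im z), sin (Im z))) with 1; [ring|].
unfold Cmod; simpl; rewrite <- sqrt_1 at 1; f_equal.
generalize (sin2_cos2 (Im z)); unfold Rsqr; lra.
Qed.

Lemma Cmod_le_Re_Im (z : C) : Cmod z <= Rabs (Re z) + Rabs (Im z).
Proof.
destruct z as [x y]; unfold Cmod; simpl.
apply Rsqr_incr_0_var; [|generalize (Rabs_pos x) (Rabs_pos y); lra].
rewrite Rsqr_sqrt by nra; unfold Rsqr.
generalize (Rabs_pos x) (Rabs_pos y) (Rsqr_abs x) (Rsqr_abs y); unfold Rsqr; nra.
Qed.

Lemma Re_le_Cmod (z : C) : Rabs (Re z) <= Cmod z.
Proof. eapply Rle_trans; [apply Rmax_l | apply Rmax_Cmod]. Qed.

Lemma Im_le_Cmod (z : C) : Rabs (Im z) <= Cmod z.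
Proof. eapply Rle_trans; [apply Rmax_r | apply Rmax_Cmod]. Qed.

(** * Derivatives of complex functions of a real variable *)

Definition cder (g : R -> C) (t : R) (l : C) : Prop :=
  is_derive (fun s => Re (g s)) t (Re l) /\ is_derive (fun s => Im (g s)) t (Im l).

Lemma cder_ext f g t l : (forall s, f s = g s) -> cder f t l -> cder g t l.
Proof.
intros E [H1 H2]; split; (eapply is_derive_ext; [|eassumption]);
  intros s; simpl; rewrite E; reflexivity.
Qed.

Lemma cder_const (c : C) t : cder (fun _ => c) t 0.
Proof. split; apply (is_derive_const (V := R_NormedModule)). Qed.

Lemma cder_id t : cder (fun s => RtoC s) t 1.
Proof.
split; simpl.
- apply (is_derive_id (K := R_AbsRing)).
- apply (is_derive_const (V := R_NormedModule)).
Qed.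

Lemma cder_plus f g t df dg :
  cder f t df -> cder g t dg -> cder (fun s => f s + g s)%C t (df + dg)%C.
Proof.
intros [f1 f2] [g1 g2]; split; simpl;
  apply (is_derive_plus (V := R_NormedModule)); assumption.
Qed.

Lemma cder_mult f g t df dg :
  cder f t df -> cder g t dg ->
  cder (fun s => f s * g s)%C t (df * g t + f t * dg)%C.
Proof.
intros [f1 f2] [g1 g2]; split; simpl.
- evar_last.
  + apply (is_derive_minus (V := R_NormedModule));
      apply (is_derive_mult (K := R_AbsRing)); eauto; intros; apply Rmult_comm.
  + unfold minus, plus, opp, mult; simpl; unfold Re, Im; ring.
- evar_last.
  + apply (is_derive_plus (V := R_NormedModule));
      apply (is_derive_mult (K := R_AbsRing)); eauto; intros; apply Rmult_comm.
  + unfold minus, plus, opp, mult; simpl; unfold Re, Im; ring.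
Qed.

Lemma cder_Cexp f t df : cder f t df -> cder (fun s => Cexp (f s)) t (df * Cexp (f t))%C.
Proof.
assert (E : forall (a b : R -> R) (da db : R), is_derive a t da -> is_derive b t db ->
  is_derive (fun s => exp (a s) * cos (b s)) t
    (da * (exp (a t) * cos (b t)) - db * (exp (a t) * sin (b t))) /\
  is_derive (fun s => exp (a s) * sin (b s)) t
    (da * (exp (a t) * sin (b t)) + db * (exp (a t) * cos (b t)))).
{ intros a b da db Ha Hb; split; auto_derive;
    try (split; [exists da | split; [exists db |]]; trivial);
    change (Derive (fun x => a x) t) with (Derive a t);
    change (Derive (fun x => b x) t) with (Derive b t);
    rewrite (is_derive_unique _ _ _ Ha), (is_derive_unique _ _ _ Hb); ring. }
intros [f1 f2]; destruct (E _ _ _ _ f1 f2) as [E1 E2].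
rewrite Cexp_pair; split.
- eapply is_derive_ext; [|exact E1]; intros s; rewrite Cexp_pair; reflexivity.
- eapply is_derive_ext; [|exact E2]; intros s; rewrite Cexp_pair; reflexivity.
Qed.

Lemma cder_CDerive g t l : cder g t l -> CDerive g t = l.
Proof.
intros [H1 H2]; unfold CDerive.
apply injective_projections; simpl; apply is_derive_unique; assumption.
Qed.

Lemma cder_ex_derive g t l :
  cder g t l -> ex_derive (K := R_AbsRing) (V := C_R_NormedModule) g t.
Proof.
intros [H1 H2]; exists l.
apply (filterdiff_ext (U := AbsRing_NormedModule R_AbsRing)
         (V := C_R_NormedModule) (fun s => (Re (g s), Im (g s)))).
{ intros s; destruct (g s); reflexivity. }
apply (filterdiff_comp'_2 (K := R_AbsRing) (T := AbsRing_NormedModule R_AbsRing)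
  (U := R_NormedModule) (V := R_NormedModule) (W := C_R_NormedModule)
  (fun s => Re (g s)) (fun s => Im (g s)) (fun a b => (a, b)) t
  (fun y => scal y (Re l)) (fun y => scal y (Im l)) (fun a b => (a, b)) H1 H2).
apply (filterdiff_linear (K := R_AbsRing)
  (U := prod_NormedModule R_AbsRing R_NormedModule R_NormedModule) (V := C_R_NormedModule)).
apply (is_linear_prod (K := R_AbsRing)); [apply is_linear_fst | apply is_linear_snd].
Qed.

(** * Taylor estimates for the exponential *)

(** The mean value theorem holds for the real and the imaginary part separately,
    at different points, which costs the factor 2. *)
Lemma cder_bound (f f' : R -> C) (M : R) :
  (forall t, cder f t (f' t)) ->
  (forall t, 0 <= t <= 1 -> Cmod (f' t) <= M) ->
  Cmod (f 1 - f 0)%C <= 2 * M.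
Proof.
intros Hd Hb.
assert (E : forall (P : C -> R), (forall z, Rabs (P z) <= Cmod z) ->
  (forall t, is_derive (fun s => P (f s)) t (P (f' t))) ->
  Rabs (P (f 1) - P (f 0)) <= M).
{ intros P HP HD.
  destruct (MVT_gen (fun s => P (f s)) 0 1 (fun t => P (f' t))) as [c [Hc E]].
  - intros x _; apply HD.
  - intros x _; apply continuity_pt_filterlim.
    apply (ex_derive_continuous (fun s => P (f s))); eexists; apply HD.
  - rewrite Rmin_left, Rmax_right in Hc by lra.
    rewrite E, Rminus_0_r, Rmult_1_r.
    eapply Rle_trans; [apply HP | apply Hb, Hc]. }
eapply Rle_trans; [apply Cmod_le_Re_Im|].
assert (E1 := E Re Re_le_Cmod (fun t => proj1 (Hd t))).
assert (E2 := E Im Im_le_Cmod (fun t => proj2 (Hd t))).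
unfold Re, Im in *; simpl; unfold Rminus in *; lra.
Qed.

Lemma cder_Cexp_line (d : C) t :
  cder (fun s => Cexp (RtoC s * d)) t (d * Cexp (RtoC t * d))%C.
Proof.
assert (H := cder_Cexp _ t _ (cder_mult _ _ t _ _ (cder_id t) (cder_const d t))).
simpl in H; replace (1 * d + t * 0)%C with d in H by ring; exact H.
Qed.

Lemma Cmod_Cexp_le z : Cmod (Cexp z) <= exp (Cmod z).
Proof.
rewrite Cmod_Cexp.
generalize (Re_le_Cmod z) (Rle_abs (Re z)); intros.
destruct (Req_dec (Re z) (Cmod z)) as [->|]; [lra|]; left; apply exp_increasing; lra.
Qed.

Lemma exp_le_exp x y : x <= y -> exp x <= exp y.
Proof. intros [H| ->]; [left; apply exp_increasing, H | lra]. Qed.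

Lemma Cmod_Cexp_line (d : C) t : 0 <= t <= 1 -> Cmod (Cexp (RtoC t * d)) <= exp (Cmod d).
Proof.
intros Ht; eapply Rle_trans; [apply Cmod_Cexp_le|]; apply exp_le_exp.
rewrite Cmod_mult, Cmod_R, Rabs_pos_eq by lra; generalize (Cmod_ge_0 d); nra.
Qed.

Lemma Cexp_taylor1 (d : C) : Cmod (Cexp d - 1)%C <= 2 * (Cmod d * exp (Cmod d)).
Proof.
assert (H := cder_bound _ _ (Cmod d * exp (Cmod d)) (cder_Cexp_line d)).
simpl in H; rewrite Cmult_1_l, Cmult_0_l, Cexp_0 in H; apply H.
intros t Ht; rewrite Cmod_mult.
apply Rmult_le_compat_l; [apply Cmod_ge_0 | apply Cmod_Cexp_line, Ht].
Qed.

(** The derivative of s -> exp (s d) - s d is d (exp (s d) - 1), which is itself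
    small by the first-order estimate. *)
Lemma Cexp_taylor2 (d : C) :
  Cmod (Cexp d - 1 - d)%C <= 4 * (Cmod d ^ 2 * exp (Cmod d)).
Proof.
assert (Hd : forall t, cder (fun s => Cexp (RtoC s * d) - RtoC s * d)%C t
                         (d * (Cexp (RtoC t * d) - 1))%C).
{ intros t.
  assert (H := cder_plus _ _ _ _ _ (cder_Cexp_line d t)
     (cder_mult _ _ t _ _ (cder_id t) (cder_const (- d) t))).
  simpl in H.
  replace (d * Cexp (t * d) + (1 * - d + t * 0))%C with (d * (Cexp (t * d) - 1))%C in H by ring.
  revert H; apply cder_ext.
  intros s; ring. }
assert (H := cder_bound _ _ (2 * (Cmod d ^ 2 * exp (Cmod d))) Hd).
simpl in H; rewrite !Cmult_1_l, !Cmult_0_l, Cexp_0 in H.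
replace (Cexp d - 1 - d)%C with (Cexp d - d - (1 - 0))%C by ring.
simpl; eapply Rle_trans; [apply H | lra].
intros t Ht; rewrite Cmod_mult.
apply Rle_trans with (Cmod d * (2 * (Cmod d * exp (Cmod d)))); [|lra].
apply Rmult_le_compat_l; [apply Cmod_ge_0|].
eapply Rle_trans; [apply Cexp_taylor1|].
assert (Cmod (t * d) <= Cmod d).
{ rewrite Cmod_mult, Cmod_R, Rabs_pos_eq by lra; generalize (Cmod_ge_0 d); nra. }
apply Rmult_le_compat_l; [lra|]; apply Rmult_le_compat; trivial using Cmod_ge_0.
- left; apply exp_pos.
- apply exp_le_exp; trivial.
Qed.

(** * Points (z1, w1, z2, w2) and the gaussians that they index *)

Notation C4 := (C * C * C * C)%type.

Definition add4 (p h : C4) : C4 := plus (p : C4_NormedModule) h.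

Definition norm4 (h : C4) : R := norm (h : C4_NormedModule).

(** The two variables are indexed by booleans, [true] for the first, so that each
    statement about one variable is proved once. *)
Definition coord (i : bool) (u : R * R) : R := if i then fst u else snd u.

Definition cz (i : bool) (p : C4) : C :=
  let '(z1, _, z2, _) := p in if i then z1 else z2.

Definition cw (i : bool) (p : C4) : C :=
  let '(_, w1, _, w2) := p in if i then w1 else w2.

Definition slice (i : bool) (phi : R * R -> C) (u : R * R) (s : R) : C :=
  if i then phi (s, snd u) else phi (fst u, s).

Lemma norm4_ge_0 h : 0 <= norm4 h.
Proof. apply norm_ge_0. Qed.

Lemma norm_pair_l {V W : NormedModule C_AbsRing} (x : V) (y : W) :
  norm x <= norm ((x, y) : prod_NormedModule _ V W).
Proof.
eapply Rle_trans, (proj1 (sqrt_plus_sqr (norm x) (norm y))).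
eapply Rle_trans, Rmax_l; apply Rle_abs.
Qed.

Lemma norm_pair_r {V W : NormedModule C_AbsRing} (x : V) (y : W) :
  norm y <= norm ((x, y) : prod_NormedModule _ V W).
Proof.
eapply Rle_trans, (proj1 (sqrt_plus_sqr (norm x) (norm y))).
eapply Rle_trans, Rmax_r; apply Rle_abs.
Qed.

Lemma cz_le i h : Cmod (cz i h) <= norm4 h.
Proof.
destruct h as [[[z1 w1] z2] w2], i; unfold norm4, C4_NormedModule.
- eapply Rle_trans, (norm_pair_l (V := C3_NormedModule)).
  eapply Rle_trans, (norm_pair_l (V := C2_NormedModule)).
  apply (norm_pair_l (V := C_NormedModule) (W := C_NormedModule)).
- eapply Rle_trans, (norm_pair_l (V := C3_NormedModule)).
  apply (norm_pair_r (V := C2_NormedModule) (W := C_NormedModule)).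
Qed.

Lemma cw_le i h : Cmod (cw i h) <= norm4 h.
Proof.
destruct h as [[[z1 w1] z2] w2], i; unfold norm4, C4_NormedModule.
- eapply Rle_trans, (norm_pair_l (V := C3_NormedModule)).
  eapply Rle_trans, (norm_pair_l (V := C2_NormedModule)).
  apply (norm_pair_r (V := C_NormedModule) (W := C_NormedModule)).
- apply (norm_pair_r (V := C3_NormedModule) (W := C_NormedModule)).
Qed.

Lemma cz_add i p h : cz i (add4 p h) = (cz i p + cz i h)%C.
Proof. destruct p as [[[? ?] ?] ?], h as [[[? ?] ?] ?], i; reflexivity. Qed.

Lemma cw_add i p h : cw i (add4 p h) = (cw i p + cw i h)%C.
Proof. destruct p as [[[? ?] ?] ?], h as [[[? ?] ?] ?], i; reflexivity. Qed.

Definition phase1 (i : bool) (p : C4) (u : R * R) : C :=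
  (cw i p * RtoC (coord i u) * RtoC (coord i u) - 2 * cz i p * RtoC (coord i u))%C.

(** The exponent without the term z^2 / w: dropping that term makes it linear
    in p, so that an increment of p factors out of the gaussian. *)
Definition phase (kappa : C) (p : C4) (u : R * R) : C :=
  (kappa * (phase1 true p u + phase1 false p u))%C.

Definition dphase (kappa : C) (i : bool) (p : C4) (u : R * R) : C :=
  (2 * kappa * (cw i p * RtoC (coord i u) - cz i p))%C.

Lemma phase_add kappa p h u :
  phase kappa (add4 p h) u = (phase kappa p u + phase kappa h u)%C.
Proof. unfold phase, phase1; rewrite !cz_add, !cw_add; ring. Qed.

Lemma dphase_add kappa i p h u :
  dphase kappa i (add4 p h) u = (dphase kappa i p u + dphase kappa i h u)%C.
Proof. unfold dphase; rewrite !cz_add, !cw_add; ring. Qed.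

Definition gauss (kappa : C) (p : C4) (u : R * R) : C := Cexp (phase kappa p u).

(** * Families of test functions stable under differentiation *)

(** Families Phi h of functions of u, indexed by increments h of p, that are
    O(|h|^k) near h = 0, with all their derivatives in u, when the gaussian at p
    decays.  The class is defined by its generators rather than by those estimates: then
    stability under differentiation is an induction that involves no estimate, and
    the pointwise bound is an induction that involves no derivative. *)
Inductive tame (kappa : C) (p : C4) : nat -> (C4 -> R * R -> C) -> Prop :=
| tame_gauss : tame kappa p 0 (fun h => gauss kappa (add4 p h))
| tame_increment : tame kappa p 1
    (fun h u => gauss kappa (add4 p h) u - gauss kappa p u)%C
| tame_remainder : tame kappa p 2
    (fun h u => gauss kappa (add4 p h) u - gauss kappa p u
                - phase kappa h u * gauss kappa p u)%C
| tame_plus k Phi Psi : tame kappa p k Phi -> tame kappa p k Psi ->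
    tame kappa p k (fun h u => Phi h u + Psi h u)%C
| tame_coef j k (c : C4 -> C) Phi :
    (exists M, forall h, norm4 h <= 1 -> Cmod (c h) <= M * norm4 h ^ j) ->
    tame kappa p k Phi -> tame kappa p (j + k) (fun h u => c h * Phi h u)%C
| tame_coord k i Phi : tame kappa p k Phi ->
    tame kappa p k (fun h u => RtoC (coord i u) * Phi h u)%C
| tame_weaken k Phi : tame kappa p (S k) Phi -> tame kappa p k Phi.

Lemma tame_ext kappa p k Phi Psi :
  (forall h u, Phi h u = Psi h u) -> tame kappa p k Phi -> tame kappa p k Psi.
Proof.
intros E H; replace Psi with Phi; trivial.
apply functional_extensionality; intros h; apply functional_extensionality, E.
Qed.

Lemma tame_scal kappa p k (c : C) Phi :
  tame kappa p k Phi -> tame kappa p k (fun h u => c * Phi h u)%C.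
Proof.
intros H; apply (tame_coef kappa p 0 k (fun _ => c)); trivial.
exists (Cmod c); intros; simpl; lra.
Qed.

Lemma tame_coef1 kappa p k c Phi :
  (forall h, Cmod (c h) <= norm4 h) -> tame kappa p k Phi ->
  tame kappa p (S k) (fun h u => c h * Phi h u)%C.
Proof.
intros Hc; apply (tame_coef kappa p 1 k c); exists 1; intros h _; simpl.
rewrite Rmult_1_l, Rmult_1_r; apply Hc.
Qed.

Lemma tame_dphase kappa p k i Phi :
  tame kappa p k Phi -> tame kappa p k (fun h u => dphase kappa i p u * Phi h u)%C.
Proof.
intros H.
apply (tame_ext _ _ _ (fun h u => 2 * kappa * cw i p * (RtoC (coord i u) * Phi h u)
                               + - (2 * kappa * cz i p) * Phi h u)%C).
{ intros h u; unfold dphase; ring. }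
apply tame_plus; apply tame_scal; trivial; apply tame_coord; trivial.
Qed.

Lemma tame_dphase_h kappa p k i Phi :
  tame kappa p k Phi -> tame kappa p (S k) (fun h u => dphase kappa i h u * Phi h u)%C.
Proof.
intros H.
apply (tame_ext _ _ _ (fun h u => 2 * kappa * (cw i h * (RtoC (coord i u) * Phi h u))
                               + - (2 * kappa) * (cz i h * Phi h u))%C).
{ intros h u; unfold dphase; ring. }
apply tame_plus; apply tame_scal; apply tame_coef1; auto using cw_le, cz_le, tame_coord.
Qed.

Lemma slice_at i phi u : slice i phi u (coord i u) = phi u.
Proof. destruct i, u; reflexivity. Qed.

(** * Partial derivatives and smoothness *)

Definition pder (i : bool) (phi : R * R -> C) (u : R * R) (l : C) : Prop :=
  cder (slice i phi u) (coord i u) l.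

Lemma pder_plus i phi psi u l m : pder i phi u l -> pder i psi u m ->
  pder i (fun v => phi v + psi v)%C u (l + m)%C.
Proof.
intros H K; generalize (cder_plus _ _ _ _ _ H K); apply cder_ext.
intros s; destruct i; reflexivity.
Qed.

Lemma pder_mult i phi psi u l m : pder i phi u l -> pder i psi u m ->
  pder i (fun v => phi v * psi v)%C u (l * psi u + phi u * m)%C.
Proof.
intros H K; generalize (cder_mult _ _ _ _ _ H K); rewrite !slice_at; apply cder_ext.
intros s; destruct i; reflexivity.
Qed.

Lemma pder_const i (c : C) u : pder i (fun _ => c) u 0.
Proof. destruct i; exact (cder_const c _). Qed.

Lemma pder_coord i j u :
  pder i (fun v => RtoC (coord j v)) u (if Bool.eqb i j then 1 else 0)%C.
Proof.
destruct i, j.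
- exact (cder_id (fst u)).
- exact (cder_const (RtoC (snd u)) (fst u)).
- exact (cder_const (RtoC (fst u)) (snd u)).
- exact (cder_id (snd u)).
Qed.

Lemma pder_Cexp i phi u l :
  pder i phi u l -> pder i (fun v => Cexp (phi v)) u (l * Cexp (phi u))%C.
Proof.
intros H; generalize (cder_Cexp _ _ _ H); rewrite !slice_at; apply cder_ext.
intros s; destruct i; reflexivity.
Qed.

Lemma pder_eq i phi u l m : pder i phi u l -> l = m -> pder i phi u m.
Proof. intros H <-; exact H. Qed.

Lemma pder_ext i phi psi u l :
  (forall v, phi v = psi v) -> pder i phi u l -> pder i psi u l.
Proof.
intros E; apply cder_ext; intros s; destruct i; apply E.
Qed.

Lemma pder_phase kappa i p u : pder i (phase kappa p) u (dphase kappa i p u).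
Proof.
apply (pder_ext _ (fun v => kappa * ((cw true p * (RtoC (coord true v) * RtoC (coord true v))
   + (- (2 * cz true p)) * RtoC (coord true v))
   + (cw false p * (RtoC (coord false v) * RtoC (coord false v))
   + (- (2 * cz false p)) * RtoC (coord false v)))))%C.
{ intros v; unfold phase, phase1; ring. }
eapply pder_eq.
- repeat match goal with
  | |- pder _ (fun v => Cplus _ _) _ _ => apply pder_plus
  | |- pder _ (fun v => Cmult _ _) _ _ => apply pder_mult
  | |- pder _ (fun v => RtoC (coord _ v)) _ _ => apply pder_coord
  | _ => apply pder_const
  end.
- unfold dphase; destruct i; simpl; ring.
Qed.

Lemma pder_gauss kappa i p u :
  pder i (gauss kappa p) u (dphase kappa i p u * gauss kappa p u)%C.
Proof. apply pder_Cexp, pder_phase. Qed.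

Lemma pder_minus i phi psi u l m : pder i phi u l -> pder i psi u m ->
  pder i (fun v => phi v - psi v)%C u (l - m)%C.
Proof.
intros H K; apply (pder_ext _ (fun v => phi v + (- (1)) * psi v)%C).
{ intros; ring. }
eapply pder_eq; [apply pder_plus; [exact H | apply pder_mult; [apply pder_const | exact K]]|].
simpl; ring.
Qed.

(** The derivative of the phase at p + h splits into that at p, a polynomial in u
    that keeps the exponent k, and that at h, which raises the exponent by one.  So
    differentiating the increment produces the increment and |h| times the
    gaussian, and differentiating the remainder produces the remainder and |h| times the
    increment. *)
Lemma tame_pder kappa p k Phi i : tame kappa p k Phi ->
  exists Psi, tame kappa p k Psi /\ forall h u, pder i (Phi h) u (Psi h u).
Proof.
intros H; induction H as [| | |k Phi Psi _ [Phi' [A1 A2]] _ [Psi' [B1 B2]]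
  |j k c Phi Hc _ [Phi' [A1 A2]]|k j Phi H [Phi' [A1 A2]]|k Phi _ [Phi' [A1 A2]]].
- eexists; split; [|intros h u; eapply pder_eq; [apply pder_gauss | rewrite dphase_add;
    rewrite Cmult_plus_distr_r; reflexivity]].
  apply tame_plus; [apply tame_dphase, tame_gauss|].
  apply tame_weaken, tame_dphase_h, tame_gauss.
- exists (fun h u => dphase kappa i p u * (gauss kappa (add4 p h) u - gauss kappa p u)
                     + dphase kappa i h u * gauss kappa (add4 p h) u)%C; split.
  + apply tame_plus; [apply tame_dphase, tame_increment | apply tame_dphase_h, tame_gauss].
  + intros h u; eapply pder_eq; [apply pder_minus; apply pder_gauss|].
    rewrite dphase_add; ring.
- exists (fun h u => dphase kappa i p u * (gauss kappa (add4 p h) u - gauss kappa p u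
                                           - phase kappa h u * gauss kappa p u)
                     + dphase kappa i h u * (gauss kappa (add4 p h) u - gauss kappa p u))%C; split.
  + apply tame_plus; [apply tame_dphase, tame_remainder | apply tame_dphase_h, tame_increment].
  + intros h u; eapply pder_eq.
    * apply pder_minus; [apply pder_minus; apply pder_gauss|].
      apply pder_mult; [apply pder_phase | apply pder_gauss].
    * rewrite dphase_add; ring.
- exists (fun h u => Phi' h u + Psi' h u)%C; split; [apply tame_plus; trivial|].
  intros; apply pder_plus; trivial.
- exists (fun h u => c h * Phi' h u)%C; split; [apply tame_coef; trivial|].
  intros h u; eapply pder_eq; [apply pder_mult; [apply pder_const | apply A2]|]; simpl; ring.
- exists (fun h u => (if Bool.eqb i j then 1 else 0) * Phi h u + RtoC (coord j u) * Phi' h u)%C.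
  split; [apply tame_plus; [apply tame_scal | apply tame_coord]; trivial|].
  intros h u; apply pder_mult; [apply pder_coord | apply A2].
- exists Phi'; split; trivial; apply tame_weaken; trivial.
Qed.

(** Continuity through the two parts, so that the rules for products apply: they
    are stated for the topology of an absolute ring, which on C is not
    definitionally that of the plane. *)
Definition ccont (phi : R * R -> C) (u : R * R) : Prop :=
  continuous (fun v => Re (phi v)) u /\ continuous (fun v => Im (phi v)) u.

Lemma ccont_continuous phi u : ccont phi u -> continuous phi u.
Proof.
intros [H1 H2].
apply (continuous_ext (fun v => (Re (phi v), Im (phi v)))).
{ intros v; destruct (phi v); reflexivity. }
apply (continuous_comp_2 (fun v => Re (phi v)) (fun v => Im (phi v)) (fun a b => (a, b))); trivial.
apply (continuous_ext (fun x : R * R => x)); [intros []; reflexivity|]; apply continuous_id.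
Qed.

Lemma ccont_const c u : ccont (fun _ => c) u.
Proof. split; apply continuous_const. Qed.

Lemma ccont_coord i u : ccont (fun v => RtoC (coord i v)) u.
Proof.
split; simpl; [|apply continuous_const].
destruct u, i; [apply continuous_fst | apply continuous_snd].
Qed.

Lemma ccont_plus phi psi u :
  ccont phi u -> ccont psi u -> ccont (fun v => phi v + psi v)%C u.
Proof.
intros [A1 A2] [B1 B2]; split; apply (continuous_plus (V := R_NormedModule)); trivial.
Qed.

Lemma ccont_mult phi psi u :
  ccont phi u -> ccont psi u -> ccont (fun v => phi v * psi v)%C u.
Proof.
intros [A1 A2] [B1 B2]; split.
- apply (continuous_minus (V := R_NormedModule)); apply (continuous_mult (K := R_AbsRing)); trivial.
- apply (continuous_plus (V := R_NormedModule)); apply (continuous_mult (K := R_AbsRing)); trivial.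
Qed.

Lemma ccont_ext phi psi u : (forall v, phi v = psi v) -> ccont phi u -> ccont psi u.
Proof.
intros E H; replace psi with phi; trivial; apply functional_extensionality, E.
Qed.

Lemma ccont_minus phi psi u :
  ccont phi u -> ccont psi u -> ccont (fun v => phi v - psi v)%C u.
Proof.
intros H K; apply (ccont_ext (fun v => phi v + (- (1)) * psi v)%C); [intros; ring|].
apply ccont_plus; trivial; apply ccont_mult; trivial; apply ccont_const.
Qed.

Lemma ccont_Cexp phi u : ccont phi u -> ccont (fun v => Cexp (phi v)) u.
Proof.
intros [A1 A2].
apply (ccont_ext (fun v => (exp (Re (phi v)) * cos (Im (phi v)), exp (Re (phi v)) * sin (Im (phi v))))).
{ intros v; rewrite Cexp_pair; reflexivity. }
assert (E : forall g, continuity g -> forall P : R * R -> R, continuous P u ->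
  continuous (fun v => g (P v)) u).
{ intros g Hg P HP; apply (continuous_comp P g); trivial.
  apply continuity_pt_filterlim, Hg. }
assert (Hexp := E _ (derivable_continuous _ derivable_exp) _ A1).
assert (Hcos := E _ continuity_cos _ A2).
assert (Hsin := E _ continuity_sin _ A2).
split.
- exact (continuous_mult (K := R_AbsRing) _ _ _ Hexp Hcos).
- exact (continuous_mult (K := R_AbsRing) _ _ _ Hexp Hsin).
Qed.

Lemma ccont_phase kappa p u : ccont (phase kappa p) u.
Proof.
unfold phase, phase1.
repeat match goal with
  | |- ccont (fun v => Cplus _ _) _ => apply ccont_plus
  | |- ccont (fun v => Cminus _ _) _ => apply ccont_minus
  | |- ccont (fun v => Cmult _ _) _ => apply ccont_mult
  | |- ccont (fun v => RtoC (coord _ v)) _ => apply ccont_coord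
  | _ => apply ccont_const
  end.
Qed.

Lemma ccont_gauss kappa p u : ccont (gauss kappa p) u.
Proof. apply ccont_Cexp, ccont_phase. Qed.

Lemma tame_ccont kappa p k Phi h u : tame kappa p k Phi -> ccont (Phi h) u.
Proof.
intros H; induction H.
- apply ccont_gauss.
- apply ccont_minus; apply ccont_gauss.
- apply ccont_minus; [apply ccont_minus; apply ccont_gauss|].
  apply ccont_mult; [apply ccont_phase | apply ccont_gauss].
- apply ccont_plus; trivial.
- apply ccont_mult; [apply ccont_const | trivial].
- apply ccont_mult; [apply ccont_coord | trivial].
- trivial.
Qed.

Definition Dir (i : bool) := if i then D1 else D2.

Lemma Dir_eq i phi phi' : (forall u, pder i phi u (phi' u)) -> Dir i phi = phi'.
Proof.
intros H; apply functional_extensionality; intros u.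
destruct i; exact (cder_CDerive _ _ _ (H u)).
Qed.

Lemma tame_smooth kappa p k Phi h : tame kappa p k Phi -> smooth (Phi h).
Proof.
intros H n; revert k Phi H; induction n as [|n IH]; intros k Phi H; split;
  try (intros u; apply ccont_continuous, (tame_ccont _ _ _ _ _ _ H)); trivial.
destruct (tame_pder _ _ _ _ true H) as [Phi1 [T1 E1]].
destruct (tame_pder _ _ _ _ false H) as [Phi2 [T2 E2]].
split; [|split].
- intros u; split; eapply cder_ex_derive; [apply (E1 h u) | apply (E2 h u)].
- change D1 with (Dir true); rewrite (Dir_eq _ _ _ (E1 h)); apply (IH _ _ T1).
- change D2 with (Dir false); rewrite (Dir_eq _ _ _ (E2 h)); apply (IH _ _ T2).
Qed.

(** The scalar c allows a family to be renormalised without changing [Psi], hence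
    without changing the constants in its seminorm bounds. *)
Lemma tame_iter kappa p k Phi m n : tame kappa p k Phi ->
  exists Psi, tame kappa p k Psi /\ forall (c : C) h,
    Nat.iter m D1 (Nat.iter n D2 (fun u => c * Phi h u)%C) = (fun u => c * Psi h u)%C.
Proof.
assert (S1 : forall i k Phi, tame kappa p k Phi -> exists Psi, tame kappa p k Psi /\
  forall (c : C) h, Dir i (fun u => c * Phi h u)%C = (fun u => c * Psi h u)%C).
{ intros i k' Phi' H; destruct (tame_pder _ _ _ _ i H) as [Psi [T E]].
  exists Psi; split; trivial; intros c h; apply Dir_eq; intros u.
  eapply pder_eq; [apply pder_mult; [apply pder_const | apply E]|]; simpl; ring. }
intros H; induction m as [|m [Psi [T E]]]; [induction n as [|n [Psi [T E]]]|].
- exists Phi; split; trivial.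
- destruct (S1 false _ _ T) as [Psi' [T' E']]; exists Psi'; split; trivial.
  intros c h; simpl in E |- *; rewrite E; apply E'.
- destruct (S1 true _ _ T) as [Psi' [T' E']]; exists Psi'; split; trivial.
  intros c h; simpl in E |- *; rewrite E; apply E'.
Qed.

(** * Pointwise bounds and Schwartz seminorms *)

Definition weight (u : R * R) : R :=
  Rabs (fst u) ^ 2 + 2 * Rabs (fst u) + (Rabs (snd u) ^ 2 + 2 * Rabs (snd u)).

Definition norm1 (u : R * R) : R := Rabs (fst u) + Rabs (snd u).

Lemma le_exp t : t <= exp t.
Proof.
destruct (Req_dec t 0) as [->|H]; [rewrite exp_0; lra|].
generalize (exp_ineq1 t H); lra.
Qed.

Lemma pow_le_exp t n : 0 <= t -> t ^ n <= exp (INR n * t).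
Proof.
intros Ht; induction n as [|n IH]; [simpl; rewrite Rmult_0_l, exp_0; lra|].
rewrite S_INR, Rmult_plus_distr_r, Rmult_1_l, Rplus_comm, exp_plus; simpl.
apply Rmult_le_compat; trivial using le_exp; apply pow_le, Ht.
Qed.

Lemma weight_ge_0 u : 0 <= weight u.
Proof. unfold weight; generalize (Rabs_pos (fst u)) (Rabs_pos (snd u)); nra. Qed.

Lemma norm1_ge_0 u : 0 <= norm1 u.
Proof. unfold norm1; generalize (Rabs_pos (fst u)) (Rabs_pos (snd u)); lra. Qed.

Lemma weight_le_exp u : weight u <= 8 * exp (norm1 u).
Proof.
assert (E : forall t, 0 <= t -> t ^ 2 + 2 * t <= 4 * exp t).
{ intros t Ht; generalize (Rmult_le_compat _ _ _ _ (ltac:(lra) : 0 <= 1 + t/2) (ltac:(lra) : 0 <= 1 + t/2)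
    (exp_ineq1_le (t / 2)) (exp_ineq1_le (t / 2))).
  rewrite <- exp_plus; replace (t / 2 + t / 2) with t by field; nra. }
assert (E1 := E _ (Rabs_pos (fst u))); assert (E2 := E _ (Rabs_pos (snd u))).
assert (F1 : exp (Rabs (fst u)) <= exp (norm1 u))
  by (apply exp_le_exp; unfold norm1; generalize (Rabs_pos (snd u)); lra).
assert (F2 : exp (Rabs (snd u)) <= exp (norm1 u))
  by (apply exp_le_exp; unfold norm1; generalize (Rabs_pos (fst u)); lra).
unfold weight; lra.
Qed.

(** Powers are absorbed by exponentials of |u1| + |u2|, and completing the square
    bounds the exponent d t - c t^2 that results in each variable by d^2 / (4 c). *)
Lemma gaussian_moments (c b : R) (i j k : nat) : 0 < c -> exists M, forall u : R * R,
  Rabs (fst u ^ i * snd u ^ j) *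
    (weight u ^ k * exp (- c * (fst u ^ 2 + snd u ^ 2) + b * norm1 u)) <= M.
Proof.
intros Hc; set (d := INR i + INR j + INR k + b).
exists (8 ^ k * exp (d ^ 2 / (2 * c))); intros u.
assert (H0 := norm1_ge_0 u).
assert (H1 : Rabs (fst u ^ i * snd u ^ j) <= exp ((INR i + INR j) * norm1 u)).
{ rewrite Rabs_mult, <- !RPow_abs, Rmult_plus_distr_r, exp_plus.
  apply Rmult_le_compat; try (apply pow_le, Rabs_pos);
    (eapply Rle_trans; [apply pow_le_exp, Rabs_pos|]); apply exp_le_exp, Rmult_le_compat_l;
    try apply pos_INR; unfold norm1; generalize (Rabs_pos (fst u)) (Rabs_pos (snd u)); lra. }
assert (H2 : weight u ^ k <= 8 ^ k * exp (INR k * norm1 u)).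
{ eapply Rle_trans; [apply pow_incr; split; [apply weight_ge_0 | apply weight_le_exp]|].
  rewrite Rpow_mult_distr; apply Rmult_le_compat_l; [apply pow_le; lra|].
  right; clear; induction k as [|k IH]; [simpl; rewrite Rmult_0_l, exp_0; lra|].
  rewrite S_INR, Rmult_plus_distr_r, Rmult_1_l, Rplus_comm, exp_plus; simpl; rewrite IH; ring. }
eapply Rle_trans.
- apply Rmult_le_compat; [apply Rabs_pos| |exact H1|].
  + apply Rmult_le_pos; [apply pow_le, weight_ge_0 | left; apply exp_pos].
  + apply Rmult_le_compat_r; [left; apply exp_pos | exact H2].
- replace (exp ((INR i + INR j) * norm1 u) *
    (8 ^ k * exp (INR k * norm1 u) * exp (- c * (fst u ^ 2 + snd u ^ 2) + b * norm1 u)))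
  with (8 ^ k * (exp ((INR i + INR j) * norm1 u) * exp (INR k * norm1 u)
         * exp (- c * (fst u ^ 2 + snd u ^ 2) + b * norm1 u))) by ring.
  rewrite <- !exp_plus; apply Rmult_le_compat_l; [apply pow_le; lra|].
  apply exp_le_exp.
  assert (E : forall t, - c * t ^ 2 + d * Rabs t <= d ^ 2 / (4 * c)).
  { intros t; rewrite <- (pow2_abs t).
    assert (0 <= c * (Rabs t - d / (2 * c)) ^ 2) by (apply Rmult_le_pos; [lra | apply pow2_ge_0]).
    replace (c * (Rabs t - d / (2 * c)) ^ 2)
      with (c * Rabs t ^ 2 - d * Rabs t + d ^ 2 / (4 * c)) in H by (field; lra). lra. }
  generalize (E (fst u)) (E (snd u)).
  replace (d ^ 2 / (2 * c)) with (d ^ 2 / (4 * c) + d ^ 2 / (4 * c)) by (field; lra).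
  replace ((INR i + INR j) * norm1 u + INR k * norm1 u +
     (- c * (fst u ^ 2 + snd u ^ 2) + b * norm1 u))
   with (- c * (fst u ^ 2 + snd u ^ 2) + d * norm1 u) by (unfold d; ring).
  unfold norm1; lra.
Qed.

(** For kappa = i pi hbar this is the condition Im w1 > 0, Im w2 > 0. *)
Definition decaying (kappa : C) (p : C4) : Prop := forall i, Re (kappa * cw i p)%C < 0.

Lemma phase_le kappa h u : Cmod (phase kappa h u) <= Cmod kappa * norm4 h * weight u.
Proof.
unfold phase; rewrite Cmod_mult, Rmult_assoc; apply Rmult_le_compat_l; [apply Cmod_ge_0|].
eapply Rle_trans; [apply Cmod_triangle|].
assert (E : forall i, Cmod (phase1 i h u) <= norm4 h * (Rabs (coord i u) ^ 2 + 2 * Rabs (coord i u))).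
{ intros i; unfold phase1, Cminus; eapply Rle_trans; [apply Cmod_triangle|].
  rewrite Cmod_opp, !Cmod_mult, !Cmod_R, (Rabs_pos_eq 2) by lra.
  generalize (cw_le i h) (cz_le i h) (Rabs_pos (coord i u)) (Cmod_ge_0 (cw i h)) (Cmod_ge_0 (cz i h)).
  generalize (Rabs (coord i u)) (Cmod (cw i h)) (Cmod (cz i h)) (norm4 h).
  intros t w z N H1 H2 H3 H4 H5.
  assert (w * (t * t) <= N * (t * t)) by (apply Rmult_le_compat_r; nra).
  assert (z * t <= N * t) by (apply Rmult_le_compat_r; nra).
  nra. }
generalize (E true) (E false); unfold weight; simpl; lra.
Qed.

Lemma Re_phase_le kappa p : decaying kappa p -> exists c b, 0 < c /\ forall u,
  Re (phase kappa p u) <= - c * (fst u ^ 2 + snd u ^ 2) + b * norm1 u.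
Proof.
intros Hp; assert (H1 := Hp true); assert (H2 := Hp false).
set (c1 := - Re (kappa * cw true p)%C); set (c2 := - Re (kappa * cw false p)%C).
set (b1 := 2 * Cmod (kappa * cz true p)%C); set (b2 := 2 * Cmod (kappa * cz false p)%C).
assert (Hb1 : 0 <= b1) by (generalize (Cmod_ge_0 (kappa * cz true p)%C); unfold b1; lra).
assert (Hb2 : 0 <= b2) by (generalize (Cmod_ge_0 (kappa * cz false p)%C); unfold b2; lra).
exists (Rmin c1 c2), (b1 + b2); split; [apply Rmin_glb_lt; unfold c1, c2; lra|].
intros u.
assert (E : forall i, Re (kappa * phase1 i p u)%C <=
  Re (kappa * cw i p)%C * coord i u ^ 2 + 2 * Cmod (kappa * cz i p)%C * Rabs (coord i u)).
{ intros i.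
  replace (Re (kappa * phase1 i p u)%C) with
    (Re (kappa * cw i p)%C * coord i u ^ 2 - 2 * (Re (kappa * cz i p)%C * coord i u))
    by (unfold phase1; generalize (coord i u) (cw i p) (cz i p); intros t [] []; destruct kappa; simpl; ring).
  assert (K : Rabs (Re (kappa * cz i p)%C * coord i u) <= Cmod (kappa * cz i p)%C * Rabs (coord i u)).
  { rewrite Rabs_mult; apply Rmult_le_compat_r; [apply Rabs_pos | apply Re_le_Cmod]. }
  apply Rabs_le_between in K; lra. }
replace (Re (phase kappa p u)) with
  (Re (kappa * phase1 true p u)%C + Re (kappa * phase1 false p u)%C)
  by (unfold phase; rewrite Cmult_plus_distr_l; reflexivity).
assert (E1 := E true); assert (E2 := E false); simpl coord in E1, E2.
fold b1 in E1; fold b2 in E2.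
replace (Re (kappa * cw true p)%C) with (- c1) in E1 by (unfold c1; ring).
replace (Re (kappa * cw false p)%C) with (- c2) in E2 by (unfold c2; ring).
assert (F1 : Rmin c1 c2 * fst u ^ 2 <= c1 * fst u ^ 2)
  by (apply Rmult_le_compat_r; [apply pow2_ge_0 | apply Rmin_l]).
assert (F2 : Rmin c1 c2 * snd u ^ 2 <= c2 * snd u ^ 2)
  by (apply Rmult_le_compat_r; [apply pow2_ge_0 | apply Rmin_r]).
unfold norm1; generalize (Rabs_pos (fst u)) (Rabs_pos (snd u)); intros.
assert (0 <= b2 * Rabs (fst u)) by (apply Rmult_le_pos; lra).
assert (0 <= b1 * Rabs (snd u)) by (apply Rmult_le_pos; lra).
lra.
Qed.

(** The bound is uniform over the ball |h| <= e, with one e for all exponents i, j: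
    only the constant M depends on them. *)
Definition decreasing (e : R) (k : nat) (Phi : C4 -> R * R -> C) : Prop :=
  forall i j, exists M, forall h, norm4 h <= e -> forall u,
    Rabs (fst u ^ i * snd u ^ j) * Cmod (Phi h u) <= M * norm4 h ^ k.

(** The radius e is such that |phase h| <= (c / 2) weight for |h| <= e, where c is
    the rate of decay of the gaussian at p: half of the decay is left. *)
Lemma decreasing_base kappa p : decaying kappa p -> exists e, 0 < e <= 1 /\
  forall k Phi,
    (forall h u, Cmod (Phi h u) <= 4 * (Cmod (phase kappa h u) ^ k
        * exp (Cmod (phase kappa h u)) * Cmod (gauss kappa p u))) ->
    decreasing e k Phi.
Proof.
intros Hp; destruct (Re_phase_le _ _ Hp) as [c [b [Hc Hb]]].
assert (Hk := Cmod_ge_0 kappa).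
assert (Hd : 0 < 2 * (Cmod kappa + 1)) by lra.
exists (Rmin 1 (c / (2 * (Cmod kappa + 1)))); split.
{ split; [apply Rmin_glb_lt; [lra | apply Rdiv_lt_0_compat; lra] | apply Rmin_l]. }
intros k Phi HPhi i j.
destruct (gaussian_moments (c / 2) (b + c) i j k) as [M HM]; [lra|].
exists (4 * Cmod kappa ^ k * M); intros h Hh u.
assert (N := norm4_ge_0 h); assert (W := weight_ge_0 u).
assert (Hs : Cmod (phase kappa h u) <= c / 2 * weight u).
{ eapply Rle_trans; [apply phase_le|]; apply Rmult_le_compat_r; trivial.
  assert (H : norm4 h <= c / (2 * (Cmod kappa + 1))) by (eapply Rle_trans; [exact Hh | apply Rmin_r]).
  apply (Rmult_le_compat_l (Cmod kappa + 1)) in H; [|lra].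
  replace ((Cmod kappa + 1) * (c / (2 * (Cmod kappa + 1)))) with (c / 2) in H by (field; lra).
  lra. }
assert (P := Cmod_ge_0 (phase kappa h u)).
assert (E : Cmod (Phi h u) <= 4 * Cmod kappa ^ k * norm4 h ^ k *
   (weight u ^ k * exp (- (c / 2) * (fst u ^ 2 + snd u ^ 2) + (b + c) * norm1 u))).
{ eapply Rle_trans; [apply HPhi|].
  rewrite !Rmult_assoc; apply Rmult_le_compat_l; [lra|].
  rewrite <- (Rmult_assoc (norm4 h ^ k)), <- (Rmult_assoc (Cmod kappa ^ k)), <- (Rmult_assoc (Cmod kappa ^ k)).
  rewrite <- !Rpow_mult_distr.
  apply Rmult_le_compat.
  - apply pow_le, P.
  - apply Rmult_le_pos; [left; apply exp_pos | apply Cmod_ge_0].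
  - apply pow_incr; split; trivial; apply phase_le.
  - unfold gauss; rewrite Cmod_Cexp, <- exp_plus; apply exp_le_exp.
    generalize (Hb u) Hs; unfold weight, norm1; rewrite !pow2_abs; lra. }
eapply Rle_trans; [apply Rmult_le_compat_l, E; apply Rabs_pos|].
replace (4 * Cmod kappa ^ k * M * norm4 h ^ k) with (4 * Cmod kappa ^ k * norm4 h ^ k * M) by ring.
rewrite <- Rmult_assoc, (Rmult_comm (Rabs _)), Rmult_assoc.
apply Rmult_le_compat_l; [|apply HM].
repeat apply Rmult_le_pos; try apply pow_le; lra.
Qed.

Lemma gauss_add kappa p h u :
  gauss kappa (add4 p h) u = (gauss kappa p u * Cexp (phase kappa h u))%C.
Proof. unfold gauss; rewrite phase_add; apply Cexp_plus. Qed.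

Lemma tame_decreasing kappa p : decaying kappa p -> exists e, 0 < e <= 1 /\
  forall k Phi, tame kappa p k Phi -> decreasing e k Phi.
Proof.
intros Hp; destruct (decreasing_base _ _ Hp) as [e [He HB]]; exists e; split; trivial.
intros k Phi H; induction H as [| | |k Phi Psi _ IH1 _ IH2
  |j k c Phi [Mc Hc] _ IH|k i Phi _ IH|k Phi _ IH].
- apply HB; intros h u; rewrite gauss_add, Cmod_mult.
  generalize (Cmod_Cexp_le (phase kappa h u)) (Cmod_ge_0 (gauss kappa p u)).
  generalize (exp_pos (Cmod (phase kappa h u))); intros.
  simpl; rewrite Rmult_1_l.
  assert (Cmod (gauss kappa p u) * Cmod (Cexp (phase kappa h u)) <=
    Cmod (gauss kappa p u) * exp (Cmod (phase kappa h u))) by (apply Rmult_le_compat_l; trivial).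
  assert (0 <= Cmod (gauss kappa p u) * exp (Cmod (phase kappa h u))) by (apply Rmult_le_pos; lra).
  lra.
- apply HB; intros h u; rewrite gauss_add.
  replace (gauss kappa p u * Cexp (phase kappa h u) - gauss kappa p u)%C
    with (gauss kappa p u * (Cexp (phase kappa h u) - 1))%C by ring.
  rewrite Cmod_mult; simpl; rewrite Rmult_1_r.
  assert (H1 := Rmult_le_compat_l _ _ _ (Cmod_ge_0 (gauss kappa p u)) (Cexp_taylor1 (phase kappa h u))).
  assert (0 <= Cmod (gauss kappa p u) * (Cmod (phase kappa h u) * exp (Cmod (phase kappa h u))))
    by (repeat apply Rmult_le_pos; try apply Cmod_ge_0; left; apply exp_pos).
  lra.
- apply HB; intros h u; rewrite gauss_add.
  replace (gauss kappa p u * Cexp (phase kappa h u) - gauss kappa p u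
             - phase kappa h u * gauss kappa p u)%C
    with (gauss kappa p u * (Cexp (phase kappa h u) - 1 - phase kappa h u))%C by ring.
  rewrite Cmod_mult.
  assert (H1 := Rmult_le_compat_l _ _ _ (Cmod_ge_0 (gauss kappa p u)) (Cexp_taylor2 (phase kappa h u))).
  lra.
- intros i j; destruct (IH1 i j) as [M1 H1], (IH2 i j) as [M2 H2].
  exists (M1 + M2); intros h Hh u.
  eapply Rle_trans; [apply Rmult_le_compat_l, Cmod_triangle; apply Rabs_pos|].
  generalize (H1 h Hh u) (H2 h Hh u); lra.
- intros a b; destruct (IH a b) as [M H].
  exists (Mc * M); intros h Hh u; rewrite Cmod_mult, pow_add.
  replace (Mc * M * (norm4 h ^ j * norm4 h ^ k)) with ((Mc * norm4 h ^ j) * (M * norm4 h ^ k)) by ring.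
  rewrite <- Rmult_assoc, (Rmult_comm (Rabs _)), Rmult_assoc.
  apply Rmult_le_compat; [apply Cmod_ge_0| |apply Hc; lra|apply H, Hh].
  apply Rmult_le_pos; [apply Rabs_pos | apply Cmod_ge_0].
- intros a b.
  destruct i; [destruct (IH (S a) b) as [M H] | destruct (IH a (S b)) as [M H]];
    exists M; intros h Hh u; rewrite Cmod_mult, Cmod_R;
    (eapply Rle_trans; [|apply (H h Hh u)]); right;
    simpl; rewrite !Rabs_mult; ring.
- intros a b; destruct (IH a b) as [M H]; exists (Rabs M); intros h Hh u.
  eapply Rle_trans; [apply H, Hh|]; simpl.
  assert (N := norm4_ge_0 h); assert (0 <= norm4 h ^ k) by (apply pow_le, N).
  apply Rle_trans with (Rabs M * (norm4 h * norm4 h ^ k)).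
  + apply Rmult_le_compat_r; [apply Rmult_le_pos; trivial | apply Rle_abs].
  + apply Rmult_le_compat_l; [apply Rabs_pos | nra].
Qed.

(** The seminorms with m, n derivatives of [Phi] are those without derivatives of
    another tame family. *)
Lemma tame_seminorm kappa p e k Phi a b m n :
  (forall k Phi, tame kappa p k Phi -> decreasing e k Phi) -> tame kappa p k Phi ->
  exists M, forall (c : C) h, norm4 h <= e ->
    seminorm_le a b m n (fun u => c * Phi h u)%C (Cmod c * (M * norm4 h ^ k)).
Proof.
intros He H; destruct (tame_iter _ _ _ _ m n H) as [Psi [T E]].
destruct (He _ _ T a b) as [M HM]; exists M; intros c h Hh u.
rewrite E, Cmod_mult.
rewrite <- Rmult_assoc, (Rmult_comm (Rabs _)), Rmult_assoc.
apply Rmult_le_compat_l; [apply Cmod_ge_0 | apply HM, Hh].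
Qed.

Lemma tame_schwartz kappa p e k Phi h :
  (forall k Phi, tame kappa p k Phi -> decreasing e k Phi) -> tame kappa p k Phi ->
  norm4 h <= e -> schwartz (Phi h).
Proof.
intros He H Hh; split; [apply (tame_smooth _ _ _ _ _ H)|].
intros a b m n; destruct (tame_seminorm _ _ _ _ _ a b m n He H) as [M HM].
exists (Cmod 1 * (M * norm4 h ^ k)).
replace (Phi h) with (fun u => 1 * Phi h u)%C; [apply HM, Hh|].
apply functional_extensionality; intros u; ring.
Qed.

Definition zero4 : C4 := (RtoC 0, RtoC 0, RtoC 0, RtoC 0).

Lemma norm4_zero4 : norm4 zero4 = 0.
Proof. exact (norm_zero (V := C4_NormedModule)). Qed.

(** * Tempered distributions on tame families *)

Lemma uniform_bound (P : nat -> R -> Prop) (N : nat) :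
  (forall n M M', M <= M' -> P n M -> P n M') -> (forall n, exists M, P n M) ->
  exists M, forall n, (n <= N)%nat -> P n M.
Proof.
intros Hm H; induction N as [|N [M IH]].
- destruct (H 0%nat) as [M HM]; exists M; intros n Hn; replace n with 0%nat by lia; trivial.
- destruct (H (S N)) as [M' HM']; exists (Rmax M M'); intros n Hn.
  destruct (Nat.eq_dec n (S N)) as [->|Hne].
  + eapply Hm, HM'; apply Rmax_r.
  + eapply Hm, IH; [apply Rmax_l | lia].
Qed.

Definition bigO (k : nat) (F : C4 -> C) : Prop := exists e M, 0 < e /\ 0 <= M /\
  forall h, norm4 h <= e -> Cmod (F h) <= M * norm4 h ^ k.

(** Continuity of T at 0 with tolerance 1 involves finitely many seminorms and a
    radius delta.  If those seminorms of Phi h are below s, then (delta / s) Phi h is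
    sent into the unit disc, so |T (Phi h)| < s / delta.  Here s is |h|^k up to a
    constant; the arbitrary eta > 0 keeps s positive at h = 0. *)
Lemma tame_tempered T kappa p k Phi : tempered T -> decaying kappa p ->
  tame kappa p k Phi -> bigO k (fun h => T (Phi h)).
Proof.
intros HT Hp H; destruct (tame_decreasing _ _ Hp) as [e [He HD]].
assert (zero_schwartz : schwartz (fun _ : R * R => RtoC 0)).
{ assert (K := tame_schwartz _ _ e _ _ zero4 HD (tame_scal _ _ _ 0%C _ H)).
  replace (fun _ : R * R => RtoC 0) with (fun u => 0 * Phi zero4 u)%C.
  - apply K; rewrite norm4_zero4; lra.
  - apply functional_extensionality; intros u; ring. }
assert (T0 : T (fun _ => 0%C) = 0%C).
{ generalize (tempered_scal _ HT 0%C _ zero_schwartz).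
  replace (fun u : R * R => (RtoC 0 * RtoC 0)%C) with (fun u : R * R => RtoC 0)
    by (apply functional_extensionality; intros; ring).
  intros ->; ring. }
destruct (tempered_continuous _ HT _ zero_schwartz (mkposreal 1 Rlt_0_1)) as [N [delta HN]].
assert (B : exists M, forall a, (a <= N)%nat -> forall b, (b <= N)%nat ->
  forall m, (m <= N)%nat -> forall n, (n <= N)%nat -> forall (c : C) h, norm4 h <= e ->
    seminorm_le a b m n (fun u => c * Phi h u)%C (Cmod c * (M * norm4 h ^ k))).
{ assert (Mono : forall a b m n (c : C) h M M', M <= M' ->
    seminorm_le a b m n (fun u => c * Phi h u)%C (Cmod c * (M * norm4 h ^ k)) ->
    seminorm_le a b m n (fun u => c * Phi h u)%C (Cmod c * (M' * norm4 h ^ k))).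
  { intros a b m n c h M M' HM HS u; eapply Rle_trans; [apply HS|].
    apply Rmult_le_compat_l; [apply Cmod_ge_0|].
    apply Rmult_le_compat_r; [apply pow_le, norm4_ge_0 | trivial]. }
  apply (uniform_bound (fun a M => forall b, (b <= N)%nat ->
    forall m, (m <= N)%nat -> forall n, (n <= N)%nat -> forall (c : C) h, norm4 h <= e ->
    seminorm_le a b m n (fun u => c * Phi h u)%C (Cmod c * (M * norm4 h ^ k))));
    [eauto|]; intros a.
  apply (uniform_bound (fun b M =>
    forall m, (m <= N)%nat -> forall n, (n <= N)%nat -> forall (c : C) h, norm4 h <= e ->
    seminorm_le a b m n (fun u => c * Phi h u)%C (Cmod c * (M * norm4 h ^ k))));
    [eauto|]; intros b.
  apply (uniform_bound (fun m M =>
    forall n, (n <= N)%nat -> forall (c : C) h, norm4 h <= e ->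
    seminorm_le a b m n (fun u => c * Phi h u)%C (Cmod c * (M * norm4 h ^ k))));
    [eauto|]; intros m.
  apply (uniform_bound (fun n M => forall (c : C) h, norm4 h <= e ->
    seminorm_le a b m n (fun u => c * Phi h u)%C (Cmod c * (M * norm4 h ^ k))));
    [eauto|]; intros n.
  apply (tame_seminorm _ _ _ _ _ a b m n HD H). }
destruct B as [M0 HM0].
set (M := Rmax M0 1).
assert (HM : 0 < M) by (eapply Rlt_le_trans; [apply Rlt_0_1 | apply Rmax_r]).
assert (Hd : 0 < delta) by apply cond_pos.
exists e, (M / delta); split; [lra|split; [left; apply Rdiv_lt_0_compat; lra|]].
intros h Hh; apply le_epsilon; intros eta Heta.
set (s := M * norm4 h ^ k + delta * eta).
assert (Hk : 0 <= norm4 h ^ k) by apply pow_le, norm4_ge_0.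
assert (Hs : 0 < s) by (unfold s; generalize (Rmult_lt_0_compat _ _ Hd Heta); nra).
set (c := RtoC (delta / s)).
assert (Hc : Cmod c = delta / s).
{ unfold c; rewrite Cmod_R; apply Rabs_pos_eq; left; apply Rdiv_lt_0_compat; lra. }
assert (K : Cmod (T (fun u => c * Phi h u) - T (fun _ => 0))%C < 1).
{ apply HN; [apply (tame_schwartz _ _ e _ _ h HD (tame_scal _ _ _ c _ H) Hh)|].
  intros a b m n Ha Hb Hm Hn.
  replace (fun u => (c * Phi h u - 0)%C) with (fun u => (c * Phi h u)%C)
    by (apply functional_extensionality; intros; ring).
  intros u; eapply Rle_trans; [apply HM0; trivial|].
  rewrite Hc; unfold Rdiv; rewrite Rmult_assoc.
  rewrite <- (Rmult_1_r delta) at 2; apply Rmult_le_compat_l; [lra|].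
  apply (Rmult_le_reg_l s); trivial; rewrite <- Rmult_assoc, Rinv_r, Rmult_1_l, Rmult_1_r by lra.
  unfold s; generalize (Rmult_lt_0_compat _ _ Hd Heta) (Rmax_l M0 1); fold M; nra. }
rewrite (tempered_scal _ HT c _ (tame_schwartz _ _ e _ _ h HD H Hh)), T0 in K.
replace (c * T (Phi h) - 0)%C with (c * T (Phi h))%C in K by ring.
rewrite Cmod_mult, Hc in K.
apply (Rmult_lt_compat_l (s / delta)) in K; [|apply Rdiv_lt_0_compat; lra].
replace (s / delta * (delta / s * Cmod (T (Phi h)))) with (Cmod (T (Phi h))) in K by (field; lra).
replace (M / delta * norm4 h ^ k + eta) with (s / delta * 1); [lra|].
unfold s; field; lra.
Qed.

(** * Differentiability with a quadratic remainder *)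

Lemma bigO_ext k F G : (forall h, F h = G h) -> bigO k F -> bigO k G.
Proof.
intros E [e [M [He [HM H]]]]; exists e, M; split; [|split]; trivial.
intros h Hh; rewrite <- E; auto.
Qed.

Lemma bigO_plus k F G : bigO k F -> bigO k G -> bigO k (fun h => F h + G h)%C.
Proof.
intros [e [M [He [HM H]]]] [e' [M' [He' [HM' H']]]].
exists (Rmin e e'), (M + M'); split; [apply Rmin_glb_lt; trivial|split; [lra|]].
intros h Hh; eapply Rle_trans; [apply Cmod_triangle|].
generalize (H h (Rle_trans _ _ _ Hh (Rmin_l _ _))) (H' h (Rle_trans _ _ _ Hh (Rmin_r _ _))); lra.
Qed.

Lemma bigO_mult j k F G : bigO j F -> bigO k G -> bigO (j + k) (fun h => F h * G h)%C.
Proof.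
intros [e [M [He [HM H]]]] [e' [M' [He' [HM' H']]]].
exists (Rmin e e'), (M * M'); split; [apply Rmin_glb_lt; trivial|split; [apply Rmult_le_pos; lra|]].
intros h Hh; rewrite Cmod_mult, pow_add.
replace (M * M' * (norm4 h ^ j * norm4 h ^ k)) with ((M * norm4 h ^ j) * (M' * norm4 h ^ k)) by ring.
apply Rmult_le_compat; try apply Cmod_ge_0; [apply H | apply H'];
  (eapply Rle_trans; [exact Hh|]); [apply Rmin_l | apply Rmin_r].
Qed.

Lemma bigO_const (c : C) : bigO 0 (fun _ => c).
Proof. exists 1, (Cmod c); split; [lra|split; [apply Cmod_ge_0|]]; intros; simpl; lra. Qed.

Lemma bigO_scal k (c : C) F : bigO k F -> bigO k (fun h => c * F h)%C.
Proof. apply (bigO_mult 0 k), bigO_const. Qed.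

Lemma bigO_weaken k F : bigO (S k) F -> bigO k F.
Proof.
intros [e [M [He [HM H]]]]; exists (Rmin e 1), M; split; [apply Rmin_glb_lt; lra|split; trivial].
intros h Hh; eapply Rle_trans; [apply H, (Rle_trans _ _ _ Hh (Rmin_l _ _))|].
apply Rmult_le_compat_l; trivial; simpl.
generalize (norm4_ge_0 h) (pow_le _ k (norm4_ge_0 h)) (Rle_trans _ _ _ Hh (Rmin_r _ _)); nra.
Qed.

Lemma bigO_cz i : bigO 1 (cz i).
Proof. exists 1, 1; split; [lra|split; [lra|]]; intros; simpl; generalize (cz_le i h); lra. Qed.

Lemma bigO_cw i : bigO 1 (cw i).
Proof. exists 1, 1; split; [lra|split; [lra|]]; intros; simpl; generalize (cw_le i h); lra. Qed.

Definition dot4 (l h : C4) : C :=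
  (cz true l * cz true h + cw true l * cw true h
   + (cz false l * cz false h + cw false l * cw false h))%C.

(** Stronger than complex differentiability at p, where the remainder is only
    o(|h|).  With O(|h|^2) the product rule needs no epsilons: the product of two
    increments is O(|h|) O(|h|). *)
Definition has_grad (F : C4 -> C) (p l : C4) : Prop :=
  bigO 2 (fun h => F (add4 p h) - F p - dot4 l h)%C.

Lemma bigO_dot4 l : bigO 1 (dot4 l).
Proof.
unfold dot4; repeat apply bigO_plus; apply bigO_scal; first [apply bigO_cz | apply bigO_cw].
Qed.

Lemma has_grad_increment F p l : has_grad F p l -> bigO 1 (fun h => F (add4 p h) - F p)%C.
Proof.
intros H; eapply bigO_ext; [|apply (bigO_plus _ _ _ (bigO_weaken _ _ H) (bigO_dot4 l))].
intros h; simpl; ring.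
Qed.

(** The shape of the gradient of a product or of a sum; taking b = 0 and
    m = [zero4], it also serves for the chain rule. *)
Definition lin2 (a : C) (l : C4) (b : C) (m : C4) : C4 :=
  (a * cz true l + b * cz true m, a * cw true l + b * cw true m,
   a * cz false l + b * cz false m, a * cw false l + b * cw false m)%C.

Lemma dot4_lin2 a l b m h : dot4 (lin2 a l b m) h = (a * dot4 l h + b * dot4 m h)%C.
Proof. unfold dot4, lin2; simpl; ring. Qed.

Lemma has_grad_mult F G p l m : has_grad F p l -> has_grad G p m ->
  has_grad (fun q => F q * G q)%C p (lin2 (G p) l (F p) m).
Proof.
intros HF HG; unfold has_grad.
apply (bigO_ext _ (fun h => (F (add4 p h) - F p) * (G (add4 p h) - G p)
  + (G p * (F (add4 p h) - F p - dot4 l h) + F p * (G (add4 p h) - G p - dot4 m h)))%C).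
{ intros h; rewrite dot4_lin2; ring. }
apply bigO_plus.
- apply (bigO_mult 1 1); eapply has_grad_increment; eassumption.
- apply bigO_plus; apply bigO_scal; trivial.
Qed.

Lemma has_grad_plus F G p l m : has_grad F p l -> has_grad G p m ->
  has_grad (fun q => F q + G q)%C p (lin2 1 l 1 m).
Proof.
intros HF HG; unfold has_grad.
apply (bigO_ext _ (fun h => (F (add4 p h) - F p - dot4 l h) + (G (add4 p h) - G p - dot4 m h)))%C.
{ intros h; rewrite dot4_lin2; ring. }
apply bigO_plus; trivial.
Qed.

Lemma bigO_zero k : bigO k (fun _ => 0%C).
Proof.
exists 1, 0; split; [lra|split; [lra|]]; intros; rewrite Cmod_0; lra.
Qed.

Lemma has_grad_const c p : has_grad (fun _ => c) p zero4.
Proof.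
apply (bigO_ext _ (fun _ => 0%C)); [|apply bigO_zero].
intros h; unfold dot4, zero4; simpl; ring.
Qed.

Definition ez (i : bool) : C4 :=
  if i then (RtoC 1, RtoC 0, RtoC 0, RtoC 0) else (RtoC 0, RtoC 0, RtoC 1, RtoC 0).

Definition ew (i : bool) : C4 :=
  if i then (RtoC 0, RtoC 1, RtoC 0, RtoC 0) else (RtoC 0, RtoC 0, RtoC 0, RtoC 1).

Lemma has_grad_cz i p : has_grad (cz i) p (ez i).
Proof.
apply (bigO_ext _ (fun _ => 0%C)); [|apply bigO_zero].
intros h; rewrite cz_add; destruct i; unfold dot4, ez; simpl; ring.
Qed.

Lemma has_grad_cw i p : has_grad (cw i) p (ew i).
Proof.
apply (bigO_ext _ (fun _ => 0%C)); [|apply bigO_zero].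
intros h; rewrite cw_add; destruct i; unfold dot4, ew; simpl; ring.
Qed.

Definition quad_diff (g : C -> C) (x d : C) : Prop := exists e M, 0 < e /\ 0 <= M /\
  forall t, Cmod t <= e -> Cmod (g (x + t) - g x - d * t)%C <= M * Cmod t ^ 2.

Lemma has_grad_comp g F p l d : has_grad F p l -> quad_diff g (F p) d ->
  has_grad (fun q => g (F q)) p (lin2 d l 0 zero4).
Proof.
intros HF [e [M [He [HM Hg]]]]; unfold has_grad.
apply (bigO_ext _ (fun h => (g (F (add4 p h)) - g (F p) - d * (F (add4 p h) - F p))
  + d * (F (add4 p h) - F p - dot4 l h)))%C.
{ intros h; rewrite dot4_lin2; ring. }
apply bigO_plus; [|apply bigO_scal, HF].
destruct (has_grad_increment _ _ _ HF) as [e1 [M1 [He1 [HM1 H1]]]].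
assert (Hpos : 0 < e / (M1 + 1)) by (apply Rdiv_lt_0_compat; lra).
exists (Rmin e1 (e / (M1 + 1))), (M * M1 ^ 2).
split; [apply Rmin_glb_lt; trivial|split; [apply Rmult_le_pos; trivial; apply pow2_ge_0|]].
intros h Hh.
assert (K := H1 h (Rle_trans _ _ _ Hh (Rmin_l _ _))); rewrite pow_1 in K.
assert (N := norm4_ge_0 h).
assert (Hs : Cmod (F (add4 p h) - F p)%C <= e).
{ eapply Rle_trans; [exact K|].
  assert (H2 := Rle_trans _ _ _ Hh (Rmin_r _ _)).
  apply (Rmult_le_compat_l (M1 + 1)) in H2; [|lra].
  replace ((M1 + 1) * (e / (M1 + 1))) with e in H2 by (field; lra); lra. }
assert (R := Hg _ Hs).
replace (F p + (F (add4 p h) - F p))%C with (F (add4 p h)) in R by ring.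
eapply Rle_trans; [exact R|]; rewrite Rmult_assoc, <- Rpow_mult_distr.
apply Rmult_le_compat_l; trivial; apply pow_incr; split; [apply Cmod_ge_0 | trivial].
Qed.

Lemma quad_diff_Cexp x : quad_diff Cexp x (Cexp x).
Proof.
exists 1, (Cmod (Cexp x) * (4 * exp 1)).
assert (E := exp_pos 1).
split; [lra|split; [apply Rmult_le_pos; [apply Cmod_ge_0 | lra]|]].
intros t Ht; rewrite Cexp_plus.
replace (Cexp x * Cexp t - Cexp x - Cexp x * t)%C with (Cexp x * (Cexp t - 1 - t))%C by ring.
rewrite Cmod_mult, Rmult_assoc; apply Rmult_le_compat_l; [apply Cmod_ge_0|].
eapply Rle_trans; [apply Cexp_taylor2|].
generalize (exp_le_exp _ _ Ht) (pow2_ge_0 (Cmod t)); nra.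
Qed.

(** For |t| <= |x| / 2 one has |x + t| >= |x| / 2, and the remainder is exactly
    t^2 / (x^2 (x + t)). *)
Lemma quad_diff_Cinv (x : C) : x <> 0%C -> quad_diff Cinv x (- / (x * x))%C.
Proof.
intros Hx; assert (P := Cmod_gt_0 x); destruct P as [P _]; specialize (P Hx).
exists (Cmod x / 2), (2 / Cmod x ^ 3).
assert (P3 : 0 < Cmod x ^ 3) by (apply pow_lt, P).
split; [lra|split; [left; apply Rdiv_lt_0_compat; lra|]].
intros t Ht.
assert (Q : Cmod x / 2 <= Cmod (x + t)%C).
{ assert (H := Cmod_triangle (x + t) (- t)); rewrite Cmod_opp in H.
  replace (x + t + - t)%C with x in H by ring; lra. }
assert (Hxt : (x + t)%C <> 0%C) by (apply Cmod_gt_0; lra).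
replace (/ (x + t) - / x - - / (x * x) * t)%C with (t * t * / (x * x * (x + t)))%C
  by (field; split; trivial).
assert (x * x * (x + t) <> 0)%C by (repeat apply Cmult_neq_0; trivial).
rewrite !Cmod_mult, Cmod_inv, !Cmod_mult by trivial.
unfold Rdiv; rewrite (Rmult_comm (2 * _)); simpl; rewrite !Rmult_1_r.
apply Rmult_le_compat_l; [generalize (Cmod_ge_0 t); nra|].
replace (2 * / (Cmod x * (Cmod x * Cmod x))) with (/ (Cmod x * Cmod x * (Cmod x / 2))) by (field; lra).
apply Rinv_le_contravar; [repeat apply Rmult_lt_0_compat; lra|].
apply Rmult_le_compat_l; nra.
Qed.

(** * Complex derivatives from gradients *)

Lemma add4_minus (p q : C4) : add4 p (minus (q : C4_NormedModule) p) = q.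
Proof.
assert (E : forall (V : AbelianGroup) (x y : V), plus x (minus y x) = y).
{ intros V x y; unfold minus.
  rewrite (plus_comm y), plus_assoc, plus_opp_r; apply plus_zero_l. }
exact (E C4_NormedModule p q).
Qed.

Definition scal4 (t : C) (v : C4) : C4 :=
  (t * cz true v, t * cw true v, t * cz false v, t * cw false v)%C.

Lemma dot4_linear l : is_linear (U := C4_NormedModule) (V := C_NormedModule) (dot4 l).
Proof.
split.
- intros x y; change (plus x y) with (add4 x y).
  change (dot4 l (add4 x y) = dot4 l x + dot4 l y)%C.
  unfold dot4; rewrite !cz_add, !cw_add; ring.
- intros c x.
  change (dot4 l (scal (c : C_AbsRing) (x : C4_NormedModule)) = c * dot4 l x)%C.
  replace (scal (c : C_AbsRing) (x : C4_NormedModule)) with (scal4 c x)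
    by (destruct x as [[[? ?] ?] ?]; reflexivity).
  unfold dot4, scal4; simpl; ring.
- set (S := Cmod (cz true l) + Cmod (cw true l) + (Cmod (cz false l) + Cmod (cw false l))).
  exists (S + 1); assert (0 <= S) by (unfold S; repeat apply Rplus_le_le_0_compat; apply Cmod_ge_0).
  split; [lra|].
  intros x; change (Cmod (dot4 l x) <= (S + 1) * norm4 x).
  assert (N := norm4_ge_0 x).
  apply Rle_trans with (S * norm4 x); [|nra].
  unfold dot4, S; rewrite !Rmult_plus_distr_r.
  repeat (eapply Rle_trans; [apply Cmod_triangle|]; apply Rplus_le_compat);
    rewrite Cmod_mult; apply Rmult_le_compat_l; auto using Cmod_ge_0, cz_le, cw_le.
Qed.

Lemma has_grad_filterdiff F p l : has_grad F p l ->
  filterdiff (K := C_AbsRing) (U := C4_NormedModule) (V := C_NormedModule) F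
    (locally (T := C4_NormedModule) p) (dot4 l).
Proof.
intros [e [M [He [HM H]]]]; split; [apply dot4_linear|].
intros x Hx eps; apply is_filter_lim_locally_unique in Hx; subst x.
apply (locally_le_locally_norm (V := C4_NormedModule)).
assert (Hpos : 0 < Rmin e (eps / (M + 1))).
{ apply Rmin_glb_lt; trivial; apply Rdiv_lt_0_compat; [apply cond_pos | lra]. }
exists (mkposreal _ Hpos); intros q Hq.
unfold ball_norm in Hq; simpl in Hq.
set (h := minus (q : C4_NormedModule) p) in *.
change (norm h) with (norm4 h) in *.
assert (Hh : norm4 h <= Rmin e (eps / (M + 1))) by (left; exact Hq).
assert (K := H h (Rle_trans _ _ _ Hh (Rmin_l _ _))).
unfold h in K at 1; rewrite add4_minus in K.
change (Cmod (F q - F p - dot4 l h)%C <= eps * norm4 h).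
eapply Rle_trans; [exact K|].
assert (H2 := Rle_trans _ _ _ Hh (Rmin_r _ _)).
apply (Rmult_le_compat_l (M + 1)) in H2; [|lra].
replace ((M + 1) * (eps / (M + 1))) with (pos eps) in H2 by (field; lra).
assert (N := norm4_ge_0 h); simpl; rewrite Rmult_1_r, <- Rmult_assoc.
apply Rmult_le_compat_r; trivial; nra.
Qed.

(** The estimate is in terms of the modulus, so it is insensitive to which of the
    two equivalent topologies of C the filter of the derivative uses. *)
Lemma quad_diff_C_derive g x d : quad_diff g x d -> C_derive g x = d.
Proof.
intros [e [M [He [HM H]]]]; apply is_C_derive_unique; split; [apply is_linear_scal_l|].
intros x' Hx eps;
apply (is_filter_lim_locally_unique (V := AbsRing_NormedModule C_AbsRing)) in Hx; subst x'.
apply (locally_le_locally_norm (V := AbsRing_NormedModule C_AbsRing)).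
assert (Hpos : 0 < Rmin e (eps / (M + 1))).
{ apply Rmin_glb_lt; trivial; apply Rdiv_lt_0_compat; [apply cond_pos | lra]. }
exists (mkposreal _ Hpos); intros y Hy.
change (Cmod (y - x)%C < Rmin e (eps / (M + 1))) in Hy.
set (t := (y - x)%C) in *.
assert (Hh : Cmod t <= Rmin e (eps / (M + 1))) by (left; exact Hy).
assert (K := H t (Rle_trans _ _ _ Hh (Rmin_l _ _))).

assert (Ey : forall z : C, (x + (z - x))%C = z) by (intros; ring).
unfold t in K at 1; rewrite (Ey y) in K.
change (Cmod (g y - g x - t * d)%C <= eps * Cmod t).
rewrite (Cmult_comm t).
eapply Rle_trans; [exact K|].
assert (H2 := Rle_trans _ _ _ Hh (Rmin_r _ _)).
apply (Rmult_le_compat_l (M + 1)) in H2; [|lra].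
replace ((M + 1) * (eps / (M + 1))) with (pos eps) in H2 by (field; lra).
assert (N := Cmod_ge_0 t); simpl; rewrite Rmult_1_r, <- Rmult_assoc.
apply Rmult_le_compat_r; trivial; nra.
Qed.

Lemma norm_pair_le {V W : NormedModule C_AbsRing} (x : V) (y : W) :
  norm ((x, y) : prod_NormedModule _ V W) <= norm x + norm y.
Proof.
change (sqrt (norm x ^ 2 + norm y ^ 2) <= norm x + norm y).
assert (X := norm_ge_0 x); assert (Y := norm_ge_0 y).
apply Rsqr_incr_0_var; [|lra].
rewrite Rsqr_sqrt by (simpl; nra); unfold Rsqr; simpl; nra.
Qed.

Lemma norm4_le h : norm4 h <=
  Cmod (cz true h) + Cmod (cw true h) + (Cmod (cz false h) + Cmod (cw false h)).
Proof.
destruct h as [[[z1 w1] z2] w2]; unfold norm4; simpl; rewrite <- Rplus_assoc.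
eapply Rle_trans; [apply (norm_pair_le (V := C3_NormedModule) (W := C_NormedModule))|].
apply Rplus_le_compat_r.
eapply Rle_trans; [apply (norm_pair_le (V := C2_NormedModule) (W := C_NormedModule))|].
apply Rplus_le_compat_r.
apply (norm_pair_le (V := C_NormedModule) (W := C_NormedModule)).
Qed.

Lemma has_grad_quad_diff F p l (v : C4) (g : C -> C) x : has_grad F p l ->
  (forall t, g (x + t)%C = F (add4 p (scal4 t v))) -> g x = F p ->
  quad_diff g x (dot4 l v).
Proof.
intros [e [M [He [HM H]]]] Hg Hx.
set (S := Cmod (cz true v) + Cmod (cw true v) + (Cmod (cz false v) + Cmod (cw false v))).
assert (HS : 0 <= S) by (unfold S; repeat apply Rplus_le_le_0_compat; apply Cmod_ge_0).
assert (N : forall t, norm4 (scal4 t v) <= S * Cmod t).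
{ intros t; eapply Rle_trans; [apply norm4_le|]; simpl; rewrite !Cmod_mult; unfold S; lra. }
exists (e / (S + 1)), (M * S ^ 2).
split; [apply Rdiv_lt_0_compat; lra|split; [apply Rmult_le_pos; trivial; apply pow2_ge_0|]].
intros t Ht.
assert (Ht' : norm4 (scal4 t v) <= e).
{ apply (Rmult_le_compat_l (S + 1)) in Ht; [|lra].
  replace ((S + 1) * (e / (S + 1))) with e in Ht by (field; lra).
  generalize (N t) (Cmod_ge_0 t); lra. }
assert (K := H _ Ht'); rewrite <- Hg, <- Hx in K.
replace (dot4 l (scal4 t v)) with (dot4 l v * t)%C in K
  by (unfold dot4, scal4; simpl; ring).
eapply Rle_trans; [exact K|]; rewrite Rmult_assoc, <- Rpow_mult_distr.
apply Rmult_le_compat_l; trivial; apply pow_incr; split; [apply norm4_ge_0 | apply N].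
Qed.

Lemma has_grad_partials F z1 w1 z2 w2 l : has_grad F (z1, w1, z2, w2) l ->
  dz1 F z1 w1 z2 w2 = cz true l /\ dw1 F z1 w1 z2 w2 = cw true l /\
  dz2 F z1 w1 z2 w2 = cz false l /\ dw2 F z1 w1 z2 w2 = cw false l.
Proof.
intros H.
assert (Z : forall a : C, (a + 0)%C = a) by (intros; ring).
assert (E : forall v g x, (forall t, g (x + t)%C = F (add4 (z1, w1, z2, w2) (scal4 t v))) ->
  g x = F (z1, w1, z2, w2) -> C_derive g x = dot4 l v).
{ intros v g x Hg Hx; apply quad_diff_C_derive.
  apply (has_grad_quad_diff F (z1, w1, z2, w2)); trivial. }
assert (A : forall t v, add4 (z1, w1, z2, w2) (scal4 t v) =
  (z1 + t * cz true v, w1 + t * cw true v, z2 + t * cz false v, w2 + t * cw false v)%C)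
  by reflexivity.
repeat split.
- unfold dz1; rewrite (E (ez true)); trivial.
  + unfold dot4; simpl; ring.
  + intros t; rewrite A; simpl; do 2 f_equal; [do 2 f_equal|]; ring.
- unfold dw1; rewrite (E (ew true)); trivial.
  + unfold dot4; simpl; ring.
  + intros t; rewrite A; simpl; do 2 f_equal; [do 2 f_equal|]; ring.
- unfold dz2; rewrite (E (ez false)); trivial.
  + unfold dot4; simpl; ring.
  + intros t; rewrite A; simpl; do 2 f_equal; [do 2 f_equal|]; ring.
- unfold dw2; rewrite (E (ew false)); trivial.
  + unfold dot4; simpl; ring.
  + intros t; rewrite A; simpl; do 2 f_equal; [do 2 f_equal|]; ring.
Qed.

Lemma bigO_near k F G : (exists e, 0 < e /\ forall h, norm4 h <= e -> F h = G h) ->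
  bigO k F -> bigO k G.
Proof.
intros [e [He E]] [e' [M [He' [HM H]]]].
exists (Rmin e e'), M; split; [apply Rmin_glb_lt; trivial|split; trivial].
intros h Hh; rewrite <- E; [apply H|]; (eapply Rle_trans; [exact Hh|]); [apply Rmin_r | apply Rmin_l].
Qed.

(** * The pairing of a distribution with the gaussians *)

Lemma tame_gauss_const kappa p : tame kappa p 0 (fun _ => gauss kappa p).
Proof.
apply (tame_ext _ _ _ (fun h u => gauss kappa (add4 p h) u
  + (- (1)) * (gauss kappa (add4 p h) u - gauss kappa p u))%C).
{ intros h u; ring. }
apply tame_plus; [apply tame_gauss|].
apply tame_scal, tame_weaken, tame_increment.
Qed.

(** For a gaussian that decays and a small fixed h, these functions form a linear
    space of Schwartz functions, on which T is therefore linear. *)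
Definition tame_at (kappa : C) (p h : C4) (phi : R * R -> C) : Prop :=
  exists Phi, tame kappa p 0 Phi /\ phi = Phi h.

Definition coord_mul (i : bool) (phi : R * R -> C) (u : R * R) : C := (RtoC (coord i u) * phi u)%C.

Lemma tame_at_gauss kappa p h : tame_at kappa p h (gauss kappa p).
Proof. exists (fun _ => gauss kappa p); split; [apply tame_gauss_const | reflexivity]. Qed.

Lemma tame_at_coord_mul kappa p h i phi : tame_at kappa p h phi -> tame_at kappa p h (coord_mul i phi).
Proof. intros [Phi [T ->]]; eexists; split; [apply tame_coord, T | reflexivity]. Qed.

Lemma tame_at_scal kappa p h (c : C) phi :
  tame_at kappa p h phi -> tame_at kappa p h (fun u => c * phi u)%C.
Proof. intros [Phi [T ->]]; eexists; split; [apply tame_scal, T | reflexivity]. Qed.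

Lemma tame_at_plus kappa p h phi psi : tame_at kappa p h phi -> tame_at kappa p h psi ->
  tame_at kappa p h (fun u => phi u + psi u)%C.
Proof.
intros [Phi [T ->]] [Psi [T' ->]]; eexists; split; [apply tame_plus; [apply T | apply T'] | reflexivity].
Qed.

Lemma tame_at_schwartz kappa p : decaying kappa p -> exists e, 0 < e /\ forall h, norm4 h <= e ->
  forall phi, tame_at kappa p h phi -> schwartz phi.
Proof.
intros Hp; destruct (tame_decreasing _ _ Hp) as [e [He HD]]; exists e; split; [lra|].
intros h Hh phi [Phi [T ->]]; apply (tame_schwartz _ _ e _ _ h HD T Hh).
Qed.

Lemma tame_at_T_plus T kappa p h : tempered T ->
  (forall phi, tame_at kappa p h phi -> schwartz phi) ->
  forall phi psi, tame_at kappa p h phi -> tame_at kappa p h psi ->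
  T (fun u => phi u + psi u)%C = (T phi + T psi)%C.
Proof. intros HT HS phi psi H1 H2; apply (tempered_plus _ HT); apply HS; trivial. Qed.

Lemma tame_at_T_scal T kappa p h : tempered T ->
  (forall phi, tame_at kappa p h phi -> schwartz phi) ->
  forall c phi, tame_at kappa p h phi -> T (fun u => c * phi u)%C = (c * T phi)%C.
Proof. intros HT HS c phi H1; apply (tempered_scal _ HT), HS; trivial. Qed.

Definition moment1 (T : (R * R -> C) -> C) kappa p (i : bool) : C :=
  T (coord_mul i (gauss kappa p)).

Definition moment2 (T : (R * R -> C) -> C) kappa p (i : bool) : C :=
  T (coord_mul i (coord_mul i (gauss kappa p))).

(** T (gauss (p + h)) is expanded by linearity into the terms of order 0 and 1 in h
    and T of the Taylor remainder, which is quadratic in h. *)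
Lemma has_grad_pairing T kappa p : tempered T -> decaying kappa p ->
  has_grad (fun q => T (gauss kappa q)) p
    (- (2 * kappa * moment1 T kappa p true), kappa * moment2 T kappa p true,
     - (2 * kappa * moment1 T kappa p false), kappa * moment2 T kappa p false)%C.
Proof.
intros HT Hp; unfold has_grad.
assert (HR := tame_tempered T _ _ _ _ HT Hp (tame_remainder kappa p)).
revert HR; apply bigO_near.
destruct (tame_at_schwartz _ _ Hp) as [e [He HS]]; exists e; split; trivial.
intros h Hh; specialize (HS h Hh).
set (Rm := fun u => (gauss kappa (add4 p h) u - gauss kappa p u - phase kappa h u * gauss kappa p u)%C).
assert (MR : tame_at kappa p h Rm).
{ eexists; split; [apply tame_weaken, tame_weaken, tame_remainder | reflexivity]. }
assert (M0 := tame_at_gauss kappa p h).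
assert (M1 := fun i => tame_at_coord_mul kappa p h i _ M0).
assert (M2 := fun i => tame_at_coord_mul kappa p h i _ (M1 i)).
assert (E : gauss kappa (add4 p h) = fun u => (Rm u + (gauss kappa p u +
  ((kappa * cw true h * coord_mul true (coord_mul true (gauss kappa p)) u
    + - (2 * kappa * cz true h) * coord_mul true (gauss kappa p) u)
   + (kappa * cw false h * coord_mul false (coord_mul false (gauss kappa p)) u
    + - (2 * kappa * cz false h) * coord_mul false (gauss kappa p) u))))%C).
{ apply functional_extensionality; intros u; unfold Rm, coord_mul, phase, phase1; ring. }
rewrite E; clear E.
repeat (rewrite (tame_at_T_plus T kappa p h HT HS); [|auto using tame_at_plus, tame_at_scal ..]).
rewrite !(tame_at_T_scal T kappa p h HT HS) by trivial.
unfold dot4, moment1, moment2; simpl; ring.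
Qed.

(** * The Helmholtz equation in terms of moments *)

Lemma Dir_Dir_gauss kappa p i : Dir i (Dir i (gauss kappa p)) = fun u =>
  (4 * kappa * kappa * cw i p * cw i p * coord_mul i (coord_mul i (gauss kappa p)) u
   + (- (8 * kappa * kappa * cw i p * cz i p) * coord_mul i (gauss kappa p) u
   + (4 * kappa * kappa * cz i p * cz i p + 2 * kappa * cw i p) * gauss kappa p u))%C.
Proof.
rewrite (Dir_eq _ _ _ (pder_gauss kappa i p)); apply Dir_eq; intros u.
apply (pder_ext _ (fun v => (2 * kappa * cw i p * RtoC (coord i v) + - (2 * kappa * cz i p)) * gauss kappa p v)%C).
{ intros v; unfold dphase; ring. }
eapply pder_eq.
- apply pder_mult; [|apply pder_gauss].
  apply pder_plus; [|apply pder_const].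
  apply pder_mult; [apply pder_const | apply pder_coord].
- unfold dphase, coord_mul; destruct i; simpl; ring.
Qed.

Lemma helmholtz_moments T kappa p k : tempered T -> helmholtz k T -> decaying kappa p ->
  (let E i := 4 * kappa * kappa * cw i p * cw i p * moment2 T kappa p i
     - 8 * kappa * kappa * cw i p * cz i p * moment1 T kappa p i
     + (4 * kappa * kappa * cz i p * cz i p + 2 * kappa * cw i p) * T (gauss kappa p) in
   E true + E false + RtoC (k ^ 2) * T (gauss kappa p) = 0)%C.
Proof.
intros HT HH Hp E; subst E; cbv beta.
destruct (tame_at_schwartz _ _ Hp) as [e [He HS]].
specialize (HS zero4); rewrite norm4_zero4 in HS; specialize (HS (Rlt_le _ _ He)).
assert (M0 := tame_at_gauss kappa p zero4).
assert (M1 := fun i => tame_at_coord_mul kappa p zero4 i _ M0).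
assert (M2 := fun i => tame_at_coord_mul kappa p zero4 i _ (M1 i)).
generalize (HH _ (HS _ M0)); unfold dist_D1, dist_D2.
change (D1 (D1 (gauss kappa p))) with (Dir true (Dir true (gauss kappa p))).
change (D2 (D2 (gauss kappa p))) with (Dir false (Dir false (gauss kappa p))).
rewrite !Dir_Dir_gauss.
repeat (rewrite (tame_at_T_plus T kappa p zero4 HT HS); [|auto using tame_at_plus, tame_at_scal ..]).
rewrite !(tame_at_T_scal T kappa p zero4 HT HS) by trivial.
fold (moment1 T kappa p true) (moment1 T kappa p false) (moment2 T kappa p true) (moment2 T kappa p false).
intros HE; etransitivity; [|exact HE]; ring.
Qed.

(** * The holomorphic function and its gradient *)

Definition ratio (i : bool) (p : C4) : C := (cz i p * (cz i p * / cw i p))%C.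

Definition prefactor (kappa : C) (p : C4) : C := Cexp (kappa * (ratio true p + ratio false p))%C.

Lemma has_grad_eq F p l m : has_grad F p l -> l = m -> has_grad F p m.
Proof. intros H <-; exact H. Qed.

Definition reduced (hbar : R) (kappa : C) (T : (R * R -> C) -> C) (p : C4) : C :=
  (RtoC hbar * (prefactor kappa p * T (gauss kappa p)))%C.

Lemma has_grad_prefactor kappa p : cw true p <> 0%C -> cw false p <> 0%C ->
  has_grad (prefactor kappa) p
    (2 * kappa * cz true p / cw true p * prefactor kappa p,
     - (kappa * (cz true p * cz true p) / (cw true p * cw true p)) * prefactor kappa p,
     2 * kappa * cz false p / cw false p * prefactor kappa p,
     - (kappa * (cz false p * cz false p) / (cw false p * cw false p)) * prefactor kappa p)%C.
Proof.
intros H1 H2; unfold prefactor.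
assert (A : forall i, cw i p <> 0%C).
{ intros []; trivial. }
assert (B : forall i, has_grad (ratio i) p
   (lin2 (cz i p * / cw i p) (ez i) (cz i p)
     (lin2 (/ cw i p) (ez i) (cz i p) (lin2 (- / (cw i p * cw i p)) (ew i) 0 zero4)))%C).
{ intros i; unfold ratio.
  apply has_grad_mult; [apply has_grad_cz|].
  apply has_grad_mult; [apply has_grad_cz|].
  apply (has_grad_comp Cinv); [apply has_grad_cw | apply quad_diff_Cinv, A]. }
eapply has_grad_eq.
- apply (has_grad_comp Cexp (fun q => kappa * (ratio true q + ratio false q))%C).
  + apply (has_grad_mult (fun _ => kappa) (fun q => ratio true q + ratio false q)%C); [apply has_grad_const|].
    apply has_grad_plus; apply B.
  + apply quad_diff_Cexp.
- unfold lin2, ratio; simpl.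
  apply f_equal2; [apply f_equal2; [apply f_equal2|]|]; field; auto.
Qed.

(** * The metamorphism *)

Lemma kernel1_gauss (hbar x y b r u : R) : 0 < r ->
  let w := (RtoC b + Ci * RtoC (r ^ 2))%C in
  let z := (RtoC x + w * RtoC y)%C in
  let kappa := (RtoC PI * Ci * RtoC hbar)%C in
  kernel1 hbar x y b r u =
   (Cexp (- (kappa * (RtoC (x ^ 2) / w)) + kappa * (z * (z * / w)))
    * Cexp (kappa * (w * RtoC u * RtoC u - 2 * z * RtoC u)))%C.
Proof.
intros Hr w z kappa.
assert (Hw : w <> 0%C).
{ intros E; apply (f_equal Im) in E; simpl in E; nra. }
unfold kernel1; rewrite <- Cexp_plus; f_equal.
replace (- (kappa * (RtoC (x ^ 2) / w)) + kappa * (z * (z * / w)))%C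
  with (kappa * (2 * RtoC x * RtoC y + w * RtoC y * RtoC y))%C
  by (unfold z; simpl; rewrite Rmult_1_r, RtoC_mult; field; exact Hw).
unfold z, w, kappa; apply injective_projections; simpl; ring.
Qed.

Lemma decaying_phase_domain (hbar : R) (z1 w1 z2 w2 : C) : 0 < hbar ->
  0 < Im w1 -> 0 < Im w2 -> decaying (RtoC PI * Ci * RtoC hbar) (z1, w1, z2, w2).
Proof.
intros Hh H1 H2.
assert (E : forall w : C, Re (RtoC PI * Ci * RtoC hbar * w)%C = - (PI * hbar * Im w))
  by (intros w; simpl; unfold Im; ring).
assert (P := Rmult_lt_0_compat _ _ PI_RGT_0 Hh).
intros []; simpl cw; rewrite E.
- generalize (Rmult_lt_0_compat _ _ P H1); lra.
- generalize (Rmult_lt_0_compat _ _ P H2); lra.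
Qed.

Lemma decaying_neq0 kappa p i : decaying kappa p -> cw i p <> 0%C.
Proof.
intros Hp E; assert (H := Hp i); rewrite E, Cmult_0_r in H; simpl in H; lra.
Qed.

Lemma schwartz_gauss kappa p : decaying kappa p -> schwartz (gauss kappa p).
Proof.
intros Hp; destruct (tame_at_schwartz _ _ Hp) as [e [He HS]].
apply (HS zero4); [rewrite norm4_zero4; lra | apply tame_at_gauss].
Qed.

Definition grad_reduced (hbar : R) (kappa : C) (T : (R * R -> C) -> C) (p : C4) : C4 :=
  let P := prefactor kappa p in let m := T (gauss kappa p) in
  let gz i := (RtoC hbar * P * (2 * kappa * cz i p / cw i p * m - 2 * kappa * moment1 T kappa p i))%C in
  let gw i := (RtoC hbar * P * (kappa * moment2 T kappa p i
     - kappa * (cz i p * cz i p) / (cw i p * cw i p) * m))%C in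
  (gz true, gw true, gz false, gw false).

Lemma has_grad_reduced hbar kappa T p : tempered T -> decaying kappa p ->
  has_grad (reduced hbar kappa T) p (grad_reduced hbar kappa T p).
Proof.
intros HT Hp.
assert (W1 := decaying_neq0 _ _ true Hp); assert (W2 := decaying_neq0 _ _ false Hp).
eapply has_grad_eq.
- apply (has_grad_mult (fun _ => RtoC hbar) (fun q => prefactor kappa q * T (gauss kappa q))%C);
    [apply has_grad_const|].
  apply (has_grad_mult (prefactor kappa) (fun q => T (gauss kappa q)));
    [apply has_grad_prefactor; trivial | apply has_grad_pairing; trivial].
- unfold lin2, grad_reduced; simpl cz; simpl cw; simpl.
  apply f_equal2; [apply f_equal2; [apply f_equal2|]|]; field; auto.
Qed.

Lemma metamorphism_reduced (hbar : R) (T : (R * R -> C) -> C) x1 y1 b1 r1 x2 y2 b2 r2 :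
  tempered T -> 0 < hbar -> 0 < r1 -> 0 < r2 ->
  metamorphism hbar T x1 y1 b1 r1 x2 y2 b2 r2 =
  calG hbar (reduced hbar (RtoC PI * Ci * RtoC hbar) T) x1 y1 b1 r1 x2 y2 b2 r2.
Proof.
intros HT Hh H1 H2.
set (w1 := (RtoC b1 + Ci * RtoC (r1 ^ 2))%C); set (z1 := (RtoC x1 + w1 * RtoC y1)%C).
set (w2 := (RtoC b2 + Ci * RtoC (r2 ^ 2))%C); set (z2 := (RtoC x2 + w2 * RtoC y2)%C).
set (kappa := (RtoC PI * Ci * RtoC hbar)%C).
assert (Hp : decaying kappa (z1, w1, z2, w2)).
{ apply decaying_phase_domain; trivial; unfold w1, w2; simpl; nra. }
unfold metamorphism, calG; fold w1 w2; fold z1 z2; fold kappa.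
set (c1 := Cexp (- (kappa * (RtoC (x1 ^ 2) / w1)) + kappa * (z1 * (z1 * / w1)))%C).
set (c2 := Cexp (- (kappa * (RtoC (x2 ^ 2) / w2)) + kappa * (z2 * (z2 * / w2)))%C).
replace (fun u => kernel1 hbar x1 y1 b1 r1 (fst u) * kernel1 hbar x2 y2 b2 r2 (snd u))%C
  with (fun u => (c1 * c2) * gauss kappa (z1, w1, z2, w2) u)%C.
2: { apply functional_extensionality; intros u.
  rewrite (kernel1_gauss hbar x1 y1 b1 r1 (fst u) H1), (kernel1_gauss hbar x2 y2 b2 r2 (snd u) H2).
  fold w1 w2; fold z1 z2; fold kappa; fold c1 c2.
  unfold gauss, phase, phase1; simpl.
  rewrite Cmult_plus_distr_l, Cexp_plus; ring. }
rewrite (tempered_scal _ HT); [|apply schwartz_gauss, Hp].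
unfold reduced, prefactor, ratio; simpl cz; simpl cw.
replace (Cexp (- RtoC PI * Ci * RtoC hbar * (RtoC (x1 ^ 2) / w1 + RtoC (x2 ^ 2) / w2)))%C
  with (Cexp (- (kappa * (RtoC (x1 ^ 2) / w1))) * Cexp (- (kappa * (RtoC (x2 ^ 2) / w2))))%C
  by (rewrite <- Cexp_plus; f_equal; unfold kappa; ring).
rewrite Cmult_plus_distr_l, Cexp_plus; unfold c1, c2; rewrite !Cexp_plus.
rewrite (RtoC_mult hbar); ring.
Qed.

Theorem corollary6 (hbar : R) (hbar_pos : 0 < hbar) (k : R)
    (f : (R * R -> C) -> C) (f_tempered : tempered f)
    (f_helmholtz : helmholtz k f) :
  exists f4 : C * C * C * C -> C,
    holomorphic_on phase_domain f4 /\
    (forall x1 y1 b1 r1 x2 y2 b2 r2 : R, 0 < r1 -> 0 < r2 ->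
       metamorphism hbar f x1 y1 b1 r1 x2 y2 b2 r2 =
       calG hbar f4 x1 y1 b1 r1 x2 y2 b2 r2) /\
    (forall z1 w1 z2 w2 : C, 0 < Im w1 -> 0 < Im w2 ->
       (2 * w1 * (z1 * dz1 f4 z1 w1 z2 w2 + w1 * dw1 f4 z1 w1 z2 w2)
        + 2 * w2 * (z2 * dz2 f4 z1 w1 z2 w2 + w2 * dw2 f4 z1 w1 z2 w2)
        + (w1 + w2 + RtoC (k ^ 2) / (2 * RtoC PI * Ci * RtoC hbar))
          * f4 (z1, w1, z2, w2))%C = 0%C).
Proof.
set (kappa := (RtoC PI * Ci * RtoC hbar)%C).
exists (reduced hbar kappa f); split; [|split].
- intros [[[z1 w1] z2] w2] [H1 H2]; eexists.
  apply has_grad_filterdiff, has_grad_reduced; trivial.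
  apply decaying_phase_domain; trivial.
- intros; apply metamorphism_reduced; trivial.
- intros z1 w1 z2 w2 H1 H2.
  assert (Hp : decaying kappa (z1, w1, z2, w2)) by (apply decaying_phase_domain; trivial).
  destruct (has_grad_partials _ _ _ _ _ _ (has_grad_reduced hbar _ _ _ f_tempered Hp)) as [-> [-> [-> ->]]].
  assert (HM := helmholtz_moments _ _ _ _ f_tempered f_helmholtz Hp).
  cbv beta zeta in HM; simpl cz in *; simpl cw in *.
  unfold reduced.
  set (p := (z1, w1, z2, w2)) in *.
  assert (W1 := decaying_neq0 _ _ true Hp); assert (W2 := decaying_neq0 _ _ false Hp).
  simpl in W1, W2.
  assert (K : kappa <> 0%C) by (intros E; rewrite E in Hp; generalize (Hp true); simpl; lra).
  unfold lin2; simpl cz; simpl cw.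
  replace (2 * RtoC PI * Ci * RtoC hbar)%C with (2 * kappa)%C by (unfold kappa; ring).
  (* The left-hand side is hbar P / (2 kappa) times the left-hand side of the
     Helmholtz equation, P being the prefactor. *)
  transitivity (RtoC hbar * prefactor kappa p / (2 * kappa) * RtoC 0)%C; [|field; exact K].
  rewrite <- HM; field; auto.
Qed.
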